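(* Let $H\in(0,\tfrac12)$, $T>0$, and let $B^{(1)},B^{(2)}$ be two independent fractional Brownian motions with Hurst index $H$. For $\varepsilon>0$ set \[ \widetilde G_\varepsilon=\int_0^T B^{(1)}_u\,\frac{B^{(2)}_{u+\varepsilon}-B^{(2)}_u}{\varepsilon}\,\mathrm du . \] Let \[ S=\sqrt{\int_0^\infty\big(|x+1|^{2H}+|x-1|^{2H}-2|x|^{2H}\big)\,\mathrm dx\times\int_0^T\big(B^{(1)}_u\big)^2\,\mathrm du}, \] and let $N\sim\mathscr N(0,1)$ be independent of $(B^{(1)},B^{(2)})$. Then, as $\varepsilon\to0$, \[ \Big(\big(B^{(1)}_t,B^{(2)}_t\big)_{t\in[0,T]},\ \varepsilon^{1/2-H}\,\widetilde G_\varepsilon\Big)\ \xrightarrow{\ \mathrm{Law}\ }\ \Big(\big(B^{(1)}_t,B^{(2)}_t\big)_{t\in[0,T]},\ N\times S\Big). \]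
   Context: A fractional Brownian motion with Hurst index $H\in(0,1)$ is a centered Gaussian process $(B_t)_{t\ge0}$ with covariance $E(B_tB_s)=\tfrac12(t^{2H}+s^{2H}-|t-s|^{2H})$ (taken with continuous paths). Convergence in law is of random elements of $C([0,T];\mathbb R^2)\times\mathbb R$. *)

(* Defs.v *)
From HB Require Import structures.
From mathcomp Require Import all_boot all_order all_algebra.
From mathcomp Require Import all_classical all_reals all_analysis.
Set Implicit Arguments. Unset Strict Implicit. Unset Printing Implicit Defensive.
Import Order.TTheory GRing.Theory Num.Theory.
Import numFieldNormedType.Exports.
Local Open Scope classical_set_scope.
Local Open Scope ring_scope.

Section defs.
Context {R : realType} {d : measure_display} {Omega : measurableType d}.
Variable P : probability Omega R.

Definition centered_gaussian (X : Omega -> R) (v : R) : Prop :=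
  forall A : set R, measurable A ->
    P (X @^-1` A) = (if v == 0 then \d_(0:R) A else normal_prob 0 (Num.sqrt v) A).

Definition fbm_cov (H s t : R) : R :=
  (s `^ (2 * H) + t `^ (2 * H) - `|t - s| `^ (2 * H)) / 2.

Definition is_fBm (H : R) (B : R -> Omega -> R) : Prop :=
  [/\ forall t, 0 <= t -> measurable_fun setT (B t),
      forall w, {within `[0, +oo[, continuous (fun t => B t w)} &
      forall (n : nat) (ts : 'I_n -> R) (a : 'I_n -> R),
        (forall i, 0 <= ts i) ->
        centered_gaussian (fun w => \sum_(i < n) a i * B (ts i) w)
          (\sum_(i < n) \sum_(j < n) a i * a j * fbm_cov H (ts i) (ts j))].

Definition cyl (B : R -> Omega -> R) (n : nat) (ts : 'I_n -> R)
  (A : 'I_n -> set R) : set Omega :=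
  [set w | forall i, A i (B (ts i) w)].

(* independence of two processes (indexed by t >= 0): independence of all
   finite-dimensional cylinder events, i.e. of the generated sigma-algebras *)
Definition indep_processes (B1 B2 : R -> Omega -> R) : Prop :=
  forall (n m : nat) (s : 'I_n -> R) (A : 'I_n -> set R)
         (t : 'I_m -> R) (C : 'I_m -> set R),
    (forall i, 0 <= s i) -> (forall j, 0 <= t j) ->
    (forall i, measurable (A i)) -> (forall j, measurable (C j)) ->
    P (cyl B1 s A `&` cyl B2 t C) = (P (cyl B1 s A) * P (cyl B2 t C))%E.

Definition indep_rv_processes (N : Omega -> R) (B1 B2 : R -> Omega -> R) : Prop :=
  forall (n m : nat) (s : 'I_n -> R) (A : 'I_n -> set R)
         (t : 'I_m -> R) (C : 'I_m -> set R) (D : set R),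
    (forall i, 0 <= s i) -> (forall j, 0 <= t j) ->
    (forall i, measurable (A i)) -> (forall j, measurable (C j)) ->
    measurable D ->
    P (N @^-1` D `&` (cyl B1 s A `&` cyl B2 t C)) =
      (P (N @^-1` D) * P (cyl B1 s A `&` cyl B2 t C))%E.

End defs.

Section weak.
Context {R : realType}.

Definition path_close (T : R) (f g : R -> R * R) (e : R) : Prop :=
  forall t, 0 <= t <= T -> `|(f t).1 - (g t).1| < e /\ `|(f t).2 - (g t).2| < e.

(* bounded continuous functionals on C([0,T]; R^2) x R (sup-norm topology);
   paths are represented as functions R -> R * R continuous on [0,T]. *)
Definition bounded_continuous_functional (T : R)
  (F : (R -> R * R) -> R -> R) : Prop :=
  (exists M : R, forall f x, `|F f x| <= M) /\
  (forall f x, {within `[0, T], continuous f} ->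
     forall e : R, 0 < e -> exists2 del : R, 0 < del &
       forall g y, {within `[0, T], continuous g} ->
         path_close T f g del -> `|x - y| < del -> `|F f x - F g y| < e).
End weak.

Definition cH {R : realType} (H : R) : R :=
  \int[lebesgue_measure]_(x in `[0%R, +oo[)
     (`|x + 1| `^ (2 * H) + `|x - 1| `^ (2 * H) - 2 * `|x| `^ (2 * H)).

Definition Gtilde {R : realType} {d} {Omega : measurableType d}
  (T : R) (B1 B2 : R -> Omega -> R) (eps : R) (w : Omega) : R :=
  \int[lebesgue_measure]_(u in `[0%R, T]) (B1 u w * ((B2 (u + eps) w - B2 u w) / eps)).

Definition Slim {R : realType} {d} {Omega : measurableType d}
  (H T : R) (B1 : R -> Omega -> R) (w : Omega) : R :=
  Num.sqrt (cH H * \int[lebesgue_measure]_(u in `[0%R, T]) (B1 u w ^+ 2)).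

(* Main.v *)
(** For [H < 1/2] the constant [cH H] vanishes, so the limit [N * Slim] is
identically [0] and no central limit theorem is involved: it is enough that
[eps^(1/2 - H) * Gtilde] tends to [0] in [L^2].

With [a = 2 H] and [D(z) = |z + eps|^a + |z - eps|^a - 2 |z|^a], independence
gives [E Gtilde^2 = 1/(2 eps^2) * int int_[0,T]^2 E(B_u B_v) D(u - v) du dv].
The kernel [D] has total mass zero: sums of [D] over a grid whose mesh divides
[eps] telescope, and the mass of [D] on [|z| <= x] is at most a constant times
[eps^2 x^(a - 1)].  Since [E(B_u B_v) = (u^a + v^a - |u - v|^a) / 2], splitting
at a small fixed distance shows that the double integral is
[o(eps^(1 + a))].  The same telescoping shows [cH H <= 0], which is all that is
needed since [Num.sqrt] is [0] on nonpositive numbers.  The double integral is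
never formed: it is bounded on Riemann sums, uniformly in the mesh, and Fatou's
lemma passes to [Gtilde].

Were the convergence to fail, there would be a sequence [eps_n -> 0] along which
it fails and along which the second moments are summable; then
[eps_n^(1/2 - H) * Gtilde] tends to [0] almost surely and dominated convergence
gives a contradiction. *)
Require Import Defs.
From HB Require Import structures.
From mathcomp Require Import all_boot all_order all_algebra.
From mathcomp Require Import all_classical all_reals all_analysis.
From mathcomp Require Import measurable_realfun ring lra zify.
Set Implicit Arguments. Unset Strict Implicit. Unset Printing Implicit Defensive.
Import Order.TTheory GRing.Theory Num.Theory.
Import numFieldNormedType.Exports.
Local Open Scope classical_set_scope.
Local Open Scope ring_scope.

(** * Powers with exponent in (0, 1) and their second differences *)

Section powR_exponent_lt1.
Context {R : realType}.
Implicit Types a x y z e : R.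

Lemma powR_nonincreasing a x y : a <= 0 -> 0 < x -> x <= y -> y `^ a <= x `^ a.
Proof.
move=> a0 x0 xy; have y0 : 0 < y by lra.
rewrite -(opprK a) [leLHS]powRN [leRHS]powRN lef_pV2 ?posrE ?powR_gt0//.
by apply: ge0_ler_powR; rewrite ?nnegrE//; lra.
Qed.

(** Scaling reduces this to [(1 + t)^a <= 1 + t]. The factor [x^(a - 1)] makes increments small far
    from the origin. *)
Lemma powR_add_le a x y : 0 < a -> a < 1 -> 0 < x -> 0 <= y ->
  (x + y) `^ a <= x `^ a + y * x `^ (a - 1).
Proof.
move=> a0 a1 x0 y0.
have -> : x + y = x * (1 + y / x) by rewrite mulrDr mulr1 mulrCA divff ?mulr1// gt_eqF.
have yx : 0 <= y / x by rewrite divr_ge0// ltW.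
rewrite powRM ?(ltW x0)//; last by lra.
have h : (1 + y / x) `^ a <= 1 + y / x by apply: ler1_powR; lra.
rewrite (le_trans (ler_wpM2l (powR_ge0 _ _) h))// mulrDr mulr1 lerD2l.
by rewrite -(mulr_powRB1 (ltW x0) a0) mulrAC mulrCA divff ?mulr1 ?gt_eqF.
Qed.

(** The linear bound is based at the larger variable, say [x]; then
    [y * x^(a - 1) <= y * y^(a - 1) = y^a]. *)
Lemma powR_subadd a x y : 0 < a -> a < 1 -> 0 <= x -> 0 <= y ->
  (x + y) `^ a <= x `^ a + y `^ a.
Proof.
move=> a0 a1 x0 y0.
have [->|xn0] := eqVneq x 0; first by rewrite add0r powR0 ?add0r// gt_eqF.
have xp : 0 < x by rewrite lt_neqAle eq_sym xn0.
wlog yx : x y x0 y0 xn0 xp / y <= x => [hw|].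
  have [yx|xy] := leP y x; first exact: hw.
  rewrite addrC [leRHS]addrC; apply: hw => //; last exact: ltW.
  - by rewrite gt_eqF// (lt_trans xp).
  - exact: (lt_trans xp).
apply: (le_trans (powR_add_le a0 a1 xp y0)); rewrite lerD2l.
have [->|yn0] := eqVneq y 0; first by rewrite mul0r powR_ge0.
have yp : 0 < y by rewrite lt_neqAle eq_sym yn0.
rewrite -[leRHS](mulr_powRB1 y0 a0) ler_wpM2l//.
by apply: powR_nonincreasing => //; lra.
Qed.

(** Convexity of the power [a^-1] at the points [x^a] and [y^a], followed by the increasing power
    [a]. *)
Lemma powR_midconcave a x y : 0 < a -> a < 1 -> 0 <= x -> 0 <= y ->
  x `^ a + y `^ a <= 2 * ((x + y) / 2) `^ a.
Proof.
move=> a0 a1 x0 y0.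
have p1 : 1 <= a^-1 by rewrite invf_ge1// ltW.
have n0 : a != 0 by rewrite gt_eqF.
have hX := powR_ge0 x a; have hY := powR_ge0 y a.
have h2 : 0 <= (2^-1 : R) <= 1 by lra.
pose t := Itv01 (andP h2).1 (andP h2).2.
have tE (u v : R) : conv t (u : R^o) (v : R^o) = (u + v) / 2.
  by rewrite convRE /= /unstable.onem; lra.
have := @convex_powR R a^-1 p1 t (x `^ a) (y `^ a).
rewrite !inE/= !in_itv/= !andbT => /(_ hX hY).
rewrite [leRHS]tE [conv t _ _]tE -!powRrM divff// !powRr1//.
move=> h.
suff : (x `^ a + y `^ a) / 2 <= ((x + y) / 2) `^ a by lra.
rewrite -[leLHS]powRr1; last by lra.
rewrite -[X in _ `^ X <= _](mulVf n0) powRrM.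
apply: ge0_ler_powR => //; rewrite ?nnegrE ?powR_ge0//; lra.
Qed.

End powR_exponent_lt1.

(** * Second differences of [|z|^a] and their sums over a grid *)

Section second_difference.
Context {R : realType} (a : R).
Hypotheses (a0 : 0 < a) (a1 : a < 1).

Definition absp (z : R) : R := `|z| `^ a.

(** For [a = 2 H], half of [diff2 a e (s - t)] is the covariance of the fractional Brownian
    increments over [[s, s + e]] and [[t, t + e]]; [diff2 a 1] is the integrand of [cH]. *)
Definition diff2 (e z : R) : R := absp (z + e) + absp (z - e) - 2 * absp z.

Lemma absp_ge0 z : 0 <= absp z. Proof. exact: powR_ge0. Qed.

Lemma absp0 : absp 0 = 0. Proof. by rewrite /absp normr0 powR0// gt_eqF. Qed.

Lemma abspN z : absp (- z) = absp z. Proof. by rewrite /absp normrN. Qed.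

Lemma ler_absp x y : `|x| <= `|y| -> absp x <= absp y.
Proof. by move=> xy; apply: ge0_ler_powR; rewrite ?nnegrE// ltW. Qed.

Lemma diff2N e z : diff2 e (- z) = diff2 e z.
Proof.
rewrite /diff2 abspN -[absp (- z + e)]abspN -[absp (- z - e)]abspN.
by rewrite !opprD !opprK [absp (z + _) + _]addrC.
Qed.

Lemma diff2_0 e : diff2 e 0 = 2 * absp e.
Proof. by rewrite /diff2 absp0 add0r sub0r abspN; ring. Qed.

(** Midpoint concavity at [z + e] and [z - e]; [e <= z] keeps both points on the half-line where the
    power is concave. *)
Lemma diff2_le0 e z : 0 <= e -> e <= z -> diff2 e z <= 0.
Proof.
move=> e0 ez; rewrite /diff2 /absp !ger0_norm; try lra.
have := @powR_midconcave R a (z + e) (z - e) a0 a1.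
have -> : (z + e + (z - e)) / 2 = z by lra.
by move=> h; have := h ltac:(lra) ltac:(lra); lra.
Qed.

Variables (h : R) (m : nat).
Hypotheses (h0 : 0 < h) (m0 : (0 < m)%N).
Let e := m%:R * h.
Let G (k : nat) : R := absp (k%:R * h).

(** The boundary term of the telescoping: the [m] grid values to the right of [i * h] are paired
    with [m] values going left from [i * h], so that every summand is nonnegative. *)
Definition halfsum (i : nat) : R :=
  \sum_(l < m) (absp ((i + l + 1)%:R * h) - absp ((i%:R - l%:R) * h)).

Let h0' : 0 <= h. Proof. exact: ltW. Qed.
Let e0 : 0 < e. Proof. by rewrite mulr_gt0// ltr0n. Qed.

(* As [diff2 e 0 = 2 * absp e], [halfsum i] is half the sum of [diff2] over the
   grid points with [|k| <= i]: telescoping leaves only the terms at the ends. *)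
Lemma sum_diff2E i :
  \sum_(k < i.+1) diff2 e (k%:R * h) = halfsum i + absp e.
Proof.
elim: i => [|i IH].
  rewrite big_ord_recl big_ord0 /= mul0r diff2_0 addr0.
  rewrite /halfsum (eq_bigr (fun l : 'I_m => G l.+1 - G l)); last first.
    by move=> l _; rewrite add0n addn1 sub0r mulNr abspN.
  rewrite -(big_mkord predT (fun l => G l.+1 - G l)) telescope_sumr//.
  by rewrite /G mul0r absp0 /e; lra.
rewrite big_ord_recr /= IH /halfsum.
set S := \sum_(l < m) _; rewrite -[RHS](subrK (S + absp e)).
rewrite addrC; congr (_ + _).
rewrite opprD addrACA subrr addr0 /S -sumrB.
pose f1 (l : nat) := absp ((i + l + 1)%:R * h).
pose f2 (l : nat) := absp ((i.+1%:R - l%:R) * h).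
rewrite (eq_bigr (fun l : 'I_m => (f1 l.+1 - f1 l) + (f2 l.+1 - f2 l))); last first.
  move=> l _; rewrite /f1 /f2.
  have -> : (i.+1%:R - l.+1%:R : R) = i%:R - l%:R by rewrite -!natr1; lra.
  have -> : (i + l.+1 + 1 = i.+1 + l + 1)%N by lia.
  by lra.
rewrite big_split /= -(big_mkord predT (fun l => f1 l.+1 - f1 l)) telescope_sumr//.
rewrite -(big_mkord predT (fun l => f2 l.+1 - f2 l)) telescope_sumr//.
rewrite /f1 /f2 /diff2 /e subr0 addn0 (addn1 i).
have -> : (i + m + 1)%:R * h = i.+1%:R * h + m%:R * h.
  by rewrite -mulrDl -natrD; congr (_%:R * _); lia.
have -> : (i.+1%:R - m%:R) * h = i.+1%:R * h - m%:R * h by rewrite mulrBl.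
lra.
Qed.

Lemma halfsum_ge0 i : 0 <= halfsum i.
Proof.
apply: sumr_ge0 => l _; rewrite subr_ge0; apply: ler_absp.
rewrite !normrM ler_wpM2r// [leRHS]ger0_norm// ler_norml.
have := ler0n R i; have := ler0n R l; rewrite !natrD; lra.
Qed.

(** Since [i + l + 1 <= |i - l| + (2 l + 1)], subadditivity bounds each summand by
    [((2 l + 1) h)^a <= (2 e)^a], uniformly in [i]. *)
Lemma halfsum_le i : halfsum i <= m%:R * absp (2 * e).
Proof.
rewrite -[X in X%:R * _](card_ord m) mulr_natl -sumr_const.
apply: ler_sum => l _; rewrite lerBlDl.
have lm : (l.+1%:R <= m%:R :> R) by rewrite ler_nat.
have l0 := ler0n R l; have i0 := ler0n R i.
have q0 : 0 <= (2 * l + 1)%:R * h by rewrite mulr_ge0.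
apply: (@le_trans _ _ ((`|(i%:R - l%:R) * h| + (2 * l + 1)%:R * h) `^ a)).
  rewrite /absp; apply: ge0_ler_powR; rewrite ?nnegrE ?addr_ge0// ?(ltW a0)//.
  rewrite ger0_norm ?mulr_ge0// normrM (ger0_norm h0') -mulrDl ler_wpM2r//.
  rewrite (natrD _ (2 * l)) (natrD _ (i + l)) (natrD _ i) natrM.
  by have := ler_norm (i%:R - l%:R : R); lra.
apply: (le_trans (powR_subadd a0 a1 _ _)) => //.
rewrite lerD2l; apply: ge0_ler_powR; rewrite ?nnegrE// ?(ltW a0)//.
rewrite ger0_norm; last by rewrite mulr_ge0// ltW.
rewrite /e mulrA ler_wpM2r// -natrM ler_nat.
by have := ltn_ord l; lia.
Qed.

(** Here all arguments stay above [r], so the linear increment bound applies. Against the uniform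
    bound this gains a factor of order [e^(1 - a)] for fixed [r]. *)
Lemma halfsum_le_decay i (r : R) : 0 < r -> r + m%:R * h <= i.+1%:R * h ->
  halfsum i <= m%:R * (2 * e * r `^ (a - 1)).
Proof.
move=> r0 ri.
rewrite -[X in X%:R * _](card_ord m) mulr_natl -sumr_const.
apply: ler_sum => l _; rewrite lerBlDl.
have lm : (l.+1%:R <= m%:R :> R) by rewrite ler_nat.
have l0 := ler0n R l.
have rl : r <= (i%:R - l%:R) * h.
  have : l.+1%:R * h <= m%:R * h by rewrite ler_wpM2r.
  by move: ri; rewrite -!natr1 !mulrDl mulNr; lra.
rewrite /absp [`|(i + l + 1)%:R * h|]ger0_norm ?mulr_ge0// ger0_norm; last by lra.
have -> : (i + l + 1)%:R * h = (i%:R - l%:R) * h + (2 * l + 1)%:R * h.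
  by rewrite (natrD _ (2 * l)) (natrD _ (i + l)) (natrD _ i) natrM; ring.
apply: (le_trans (powR_add_le a0 a1 _ _)); [lra|by rewrite mulr_ge0|].
rewrite lerD2l; apply: ler_pM => //; rewrite ?powR_ge0 ?mulr_ge0//.
  rewrite /e mulrA ler_wpM2r// -natrM ler_nat.
  by have := ltn_ord l; lia.
by apply: powR_nonincreasing => //; rewrite subr_le0 ltW.
Qed.

End second_difference.

Lemma sum_ord_subnKC (V : nmodType) (f : nat -> V) (p q : nat) : (p <= q)%N ->
  \sum_(k < q) f k = \sum_(k < p) f k + \sum_(k < q - p) f (p + k)%N.
Proof.
move=> pq; rewrite -(big_mkord predT f) (big_cat_nat _ (n := p))//= big_mkord.
congr (_ + _); rewrite -[in LHS](add0n p) big_addn big_mkord.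
by apply: eq_bigr => k _; rewrite addnC.
Qed.

(** * The covariance quadratic form on a grid *)

Section grid_quadratic_form.
Context {R : realType} (a : R).
Hypotheses (a0 : 0 < a) (a1 : a < 1).
Variables (h : R) (m : nat).
Hypotheses (h0 : 0 < h) (m0 : (0 < m)%N).
Let e := m%:R * h.
Let e0 : 0 < e. Proof. by rewrite mulr_gt0// ltr0n. Qed.

(** The row is cut at its diagonal entry into two one-sided sums; both contain the index [0], hence
    the correction [f 0]. *)
Lemma even_row_sum (f : R -> R) (i n : nat) : (forall z, f (- z) = f z) ->
  (i < n)%N ->
  \sum_(j < n) f ((i%:R - j%:R) * h) =
  \sum_(k < i.+1) f (k%:R * h) + \sum_(k < n - i) f (k%:R * h) - f 0.
Proof.
move=> fN ltin.
rewrite -(big_mkord predT (fun j => f ((i%:R - j%:R) * h))).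
rewrite (big_cat_nat _ (n := i.+1))//=.
rewrite big_mkord -addrA; congr (_ + _).
  rewrite (reindex_inj rev_ord_inj)/=; apply: eq_bigr => k _.
  rewrite subSS natrB; last by have := ltn_ord k; lia.
  by congr (f (_ * h)); rewrite opprB addrC subrK.
have -> : (n - i = (n - i.+1).+1)%N by lia.
rewrite big_ord_recl /= mul0r addrAC subrr add0r.
rewrite -[in LHS](add0n i.+1) big_addn big_mkord; apply: eq_bigr => k _.
rewrite -fN -mulNr opprB; congr (f (_ * h)).
by rewrite -natrB; [congr (_%:R); rewrite /bump /=|]; lia.
Qed.

(** The two one-sided sums contribute [absp e] each, which [diff2 e 0 = 2 * absp e] cancels exactly:
    only boundary terms survive, the discrete form of zero total mass. *)
Lemma diff2_row_sum (i n : nat) : (i < n)%N ->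
  \sum_(j < n) diff2 a e ((i%:R - j%:R) * h) =
  halfsum a h m i + halfsum a h m (n - i).-1.
Proof.
move=> ltin; rewrite (even_row_sum (diff2N _ _))//.
have -> : (n - i = (n - i).-1.+1)%N by lia.
rewrite !sum_diff2E// diff2_0//=; ring.
Qed.

(** [L] is the cutoff between near and far indices: [K1] bounds every boundary term, while the much
    smaller [K2] of the application bounds those beyond the cutoff. *)
Variables (n L : nat) (T K1 K2 : R).
Hypothesis nT : n%:R * h <= T.
Hypothesis mL : (m <= L)%N.
Hypothesis eK1 : m%:R * absp a e <= K1.
Hypothesis VK1 : forall i, halfsum a h m i <= K1.
Hypothesis VK2 : forall i, (L <= i.+1)%N -> halfsum a h m i <= K2.

Let K10 : 0 <= K1.
Proof. exact: le_trans (halfsum_ge0 a0 h m 0) (VK1 0). Qed.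

Let K20 : 0 <= K2.
Proof. exact: le_trans (halfsum_ge0 a0 h m L) (VK2 (leqnSn L)). Qed.

Let T0 : 0 <= T.
Proof. by apply: le_trans nT; rewrite mulr_ge0// ltW. Qed.

Let absp_grid_le (i j : nat) : (i <= j)%N -> absp a (i%:R * h) <= absp a (j%:R * h).
Proof.
move=> ij; apply: ler_absp => //; rewrite !ger0_norm ?mulr_ge0// ?(ltW h0)//.
by rewrite ler_wpM2r ?(ltW h0)// ler_nat.
Qed.

Let absp_grid_leT (i : nat) : (i <= n)%N -> absp a (i%:R * h) <= T `^ a.
Proof.
move=> ilt; apply: (le_trans (absp_grid_le ilt)).
rewrite /absp ger0_norm ?mulr_ge0// ?(ltW h0)//.
by apply: ge0_ler_powR; rewrite ?nnegrE ?mulr_ge0// ?(ltW h0)// ?(ltW a0).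
Qed.

Lemma sum_halfsum_le :
  \sum_(i < n) halfsum a h m i <= L%:R * K1 + n%:R * K2.
Proof.
apply: (@le_trans _ _ (\sum_(i < n) ((if (i < L)%N then K1 else 0) + K2))).
  apply: ler_sum => i _; case: ltnP => iL.
    by rewrite (le_trans (VK1 _))// lerDl.
  by rewrite add0r VK2// (leq_trans iL).
rewrite big_split/= sumr_const card_ord -[K2 *+ _]mulr_natl lerD2r.
suff -> : \sum_(i < n) (if (i < L)%N then K1 else 0) = (minn n L)%:R * K1.
  by rewrite ler_wpM2r// ler_nat geq_minr.
elim: n => [|k IH]; first by rewrite big_ord0 min0n mul0r.
rewrite big_ord_recr/= IH; case: ltnP => kL.
  have -> : minn k.+1 L = k.+1 by lia.
  by rewrite -natr1 mulrDl mul1r.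
by rewrite addr0; congr (_%:R * _); lia.
Qed.

(** The kernel enters the quadratic form with weight [- |z|^a], so an upper bound has to control
    only its negative part. *)
Let Dm z := Num.max (- diff2 a e z) 0.

Let Dm_ge0 z : 0 <= Dm z. Proof. by rewrite le_max lexx orbT. Qed.

(** From index [m] on the kernel is nonpositive, so the sum telescopes to a difference of two
    [halfsum]s, of which the subtracted one is nonnegative. *)
Let sum_Dm_block (p q : nat) : (m <= p)%N -> (p <= q)%N ->
  \sum_(k < q - p) Dm ((p + k)%:R * h) <= halfsum a h m p.-1.
Proof.
move=> mp pq.
rewrite (eq_bigr (fun k : 'I_(q - p) => - diff2 a e ((p + k)%:R * h))); last first.
  move=> k _; rewrite /Dm; apply/max_idPl; rewrite oppr_ge0 diff2_le0 ?(ltW e0)//.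
  by rewrite ler_wpM2r ?(ltW h0)// ler_nat; lia.
rewrite sumrN.
have E1 : \sum_(k < q) diff2 a e (k%:R * h) = halfsum a h m q.-1 + absp a e.
  by rewrite -sum_diff2E// prednK//; lia.
have E2 : \sum_(k < p) diff2 a e (k%:R * h) = halfsum a h m p.-1 + absp a e.
  by rewrite -sum_diff2E// prednK//; lia.
move: E1; rewrite (sum_ord_subnKC (fun k => diff2 a e (k%:R * h)) pq) E2.
by have := halfsum_ge0 a0 h m q.-1; lra.
Qed.

Let sum_Dm_head : \sum_(k < L) Dm (k%:R * h) <= 3 * K1.
Proof.
rewrite (sum_ord_subnKC (fun k => Dm (k%:R * h)) mL).
have -> : 3 * K1 = 2 * K1 + K1 by ring.
apply: lerD; last by apply: le_trans (sum_Dm_block (leqnn m) mL) (VK1 _).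
(* Below index [m] only the central term [2 |z|^a] can make the second difference negative, and it
   is at most [2 e^a]. *)
apply: (@le_trans _ _ (\sum_(k < m) 2 * absp a e)).
  apply: ler_sum => k _; rewrite /Dm ge_max mulr_ge0 ?absp_ge0// andbT.
  rewrite /diff2 opprB lerBlDr.
  have : absp a (k%:R * h) <= absp a e by rewrite absp_grid_le// ltnW.
  have := absp_ge0 a (k%:R * h + e); have := absp_ge0 a (k%:R * h - e).
  by lra.
by rewrite sumr_const card_ord -[_ *+ m]mulr_natl mulrCA ler_wpM2l.
Qed.

(** Before the cutoff the weight is small, at most [absp (L h)]; beyond it the mass of the kernel is
    small, at most [K2]. *)
Lemma sum_diff2_neg_le :
  \sum_(k < n) absp a (k%:R * h) * Dm (k%:R * h) <=
  3 * (absp a (L%:R * h) * K1) + T `^ a * K2.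
Proof.
have Ha k : (k <= L)%N -> absp a (k%:R * h) * Dm (k%:R * h) <=
    absp a (L%:R * h) * Dm (k%:R * h).
  by move=> kL; rewrite ler_wpM2r// absp_grid_le.
have H1 : absp a (L%:R * h) * \sum_(k < L) Dm (k%:R * h) <=
    3 * (absp a (L%:R * h) * K1).
  by rewrite mulrCA ler_wpM2l ?absp_ge0.
have [nL|Ln] := leqP n L.
  rewrite -[leLHS]addr0 lerD ?mulr_ge0 ?powR_ge0//.
  apply: le_trans H1.
  rewrite mulr_sumr (sum_ord_subnKC (fun k => absp a (L%:R * h) * Dm (k%:R * h)) nL).
  rewrite -[leLHS]addr0 lerD//.
    by apply: ler_sum => k _; rewrite Ha// (leq_trans _ nL)// ltnW.
  by apply: sumr_ge0 => k _; rewrite mulr_ge0 ?absp_ge0.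
rewrite (sum_ord_subnKC (fun k => absp a (k%:R * h) * Dm (k%:R * h)) (ltnW Ln)) lerD//.
  apply: le_trans H1; rewrite mulr_sumr.
  by apply: ler_sum => k _; rewrite Ha// ltnW.
apply: (@le_trans _ _ (T `^ a * \sum_(k < n - L) Dm ((L + k)%:R * h))).
  rewrite mulr_sumr; apply: ler_sum => k _.
  by rewrite ler_wpM2r// absp_grid_leT// ltnW// -ltn_subRL.
rewrite ler_wpM2l ?powR_ge0//; apply: le_trans (sum_Dm_block mL (ltnW Ln)) (VK2 _).
by rewrite (ltn_predK (leq_trans m0 mL)).
Qed.

(** The covariance is split into its three terms. The first two depend on one index each, so row
    sums suffice and symmetry makes them equal; the third is handled through the negative part. *)
Lemma grid_quadratic_form_le :
  \sum_(i < n) \sum_(j < n)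
    (absp a (i%:R * h) + absp a (j%:R * h) - absp a ((i%:R - j%:R) * h)) / 2
     * diff2 a e ((i%:R - j%:R) * h) <=
  2 * (T `^ a * (L%:R * K1 + n%:R * K2)) +
  n%:R * (3 * (absp a (L%:R * h) * K1) + T `^ a * K2).
Proof.
pose D (i j : nat) := diff2 a e ((i%:R - j%:R) * h).
pose g (i : nat) := absp a (i%:R * h).
have Dsym i j : D i j = D j i.
  by rewrite /D -diff2N -mulNr opprB.
rewrite (eq_bigr (fun i : 'I_n => \sum_(j < n) (g i / 2 * D i j) +
   \sum_(j < n) (g j / 2 * D i j) +
   \sum_(j < n) (- (absp a ((i%:R - j%:R) * h) * D i j) / 2))); last first.
  move=> i _; rewrite -!big_split/=; apply: eq_bigr => j _.
  by rewrite /g /D; field.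
rewrite !big_split/=; apply: lerD.
  rewrite [X in _ + X]exchange_big/=.
  rewrite (eq_bigr (fun i : 'I_n => \sum_(j < n) (g i / 2 * D i j))); last by [].
  rewrite [X in _ + X](eq_bigr (fun i : 'I_n => \sum_(j < n) (g i / 2 * D i j))); last first.
    by move=> i _; apply: eq_bigr => j _; rewrite Dsym.
  suff H : \sum_(i < n) \sum_(j < n) g i / 2 * D i j <= T `^ a * (L%:R * K1 + n%:R * K2).
    by rewrite [leRHS]mulr_natl mulr2n lerD.
  apply: (@le_trans _ _ (\sum_(i < n) T `^ a / 2 * (halfsum a h m i + halfsum a h m (n - i).-1))).
    apply: ler_sum => i _; rewrite -mulr_sumr diff2_row_sum//.
    rewrite ler_wpM2r ?addr_ge0 ?halfsum_ge0//.
    by rewrite ler_wpM2r// absp_grid_leT// ltnW.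
  rewrite -mulr_sumr big_split/= -mulrA ler_wpM2l ?powR_ge0//.
  (* The indices [(n - i).-1] run through the same range in reverse. *)
  rewrite [X in _ + X](reindex_inj rev_ord_inj)/=.
  rewrite [X in _ + X](eq_bigr (fun i : 'I_n => halfsum a h m i)); last first.
    by move=> i _; rewrite subKn.
  by have := sum_halfsum_le; lra.
apply: (@le_trans _ _ (\sum_(i < n) (3 * (absp a (L%:R * h) * K1) + T `^ a * K2))); last first.
  by rewrite sumr_const card_ord -[leLHS]mulr_natl.
apply: ler_sum => i _.
pose f z := absp a z * Dm z.
have f0 z : 0 <= f z by rewrite mulr_ge0 ?absp_ge0// le_max lexx orbT.
apply: (@le_trans _ _ ((\sum_(j < n) f ((i%:R - j%:R) * h)) / 2)).
  rewrite mulr_suml; apply: ler_sum => j _.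
  rewrite ler_wpM2r// -mulrN ler_wpM2l ?absp_ge0// le_max.
  by rewrite lexx.
have fN z : f (- z) = f z by rewrite /f /Dm abspN diff2N.
rewrite (even_row_sum fN)//.
(* Each of the two one-sided sums is at most the full sum, and the factor [1 / 2] absorbs the
   doubling. *)
have S (k : nat) : (k <= n)%N -> \sum_(j < k) f (j%:R * h) <= \sum_(j < n) f (j%:R * h).
  move=> kn; rewrite (sum_ord_subnKC (fun j => f (j%:R * h)) kn) lerDl.
  by apply: sumr_ge0.
have := S _ (ltn_ord i); have := S _ (leq_subr i n); have := f0 0.
by have := sum_diff2_neg_le; rewrite /f; lra.
Qed.

End grid_quadratic_form.

Lemma powR_small (R : realType) (p d : R) : 0 < p -> 0 < d ->
  exists2 x0 : R, 0 < x0 & forall x, 0 <= x -> x <= x0 -> x `^ p <= d.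
Proof.
move=> p0 d0; exists (d `^ p^-1); first exact: powR_gt0.
move=> x x0 xd; apply: (@le_trans _ _ ((d `^ p^-1) `^ p)).
  by apply: ge0_ler_powR; rewrite ?nnegrE ?powR_ge0 ?(ltW p0).
by rewrite -powRrM mulVf ?powRr1 ?(ltW d0)// gt_eqF.
Qed.

(** The cutoff is put at a fixed distance [lam]. The [K1] terms are of order [e^(1 + a)], which the
    prefactor cancels exactly, and are made small by [lam]; the [K2] terms are of order [e^2] and
    leave [e^(1 - a)], made small by [e] once [lam] is fixed. Nothing depends on the mesh. *)
Lemma grid_quadratic_form_small (R : realType) (a T delta : R) :
  0 < a -> a < 1 -> 0 < T -> 0 < delta ->
  exists2 e0 : R, 0 < e0 & forall (e h : R) (m n : nat),
    0 < e -> e < e0 -> (0 < m)%N -> e = m%:R * h -> n%:R * h <= T ->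
    e `^ (1 - a) / e ^+ 2 * (h ^+ 2 * \sum_(i < n) \sum_(j < n)
      (absp a (i%:R * h) + absp a (j%:R * h) - absp a ((i%:R - j%:R) * h)) / 2
      * diff2 a e ((i%:R - j%:R) * h)) <= delta.
Proof.
move=> a0 a1 T0 d0.
(* [C * lam^a] will bound the [K1] terms; the leading [2] comes from [2^a <= 2]. *)
pose C := 2 * (2 * T `^ a + 3 * T).
have Ta0 := powR_ge0 T a.
have C0 : 0 < C by rewrite /C; lra.
have [x0 x00 hx0] := @powR_small R a (delta / 2 / C) a0 (divr_gt0 (divr_gt0 d0 (ltr0n _ 2)) C0).
pose lam := Num.min 1 x0.
have lam0 : 0 < lam by rewrite lt_min ltr01.
have lam1 : lam <= 1 by rewrite ge_min lexx.
have laml : lam `^ a <= delta / 2 / C.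
  by apply: hx0; [exact: ltW|rewrite ge_min lexx orbT].
have lama : lam <= lam `^ a by apply: ger1_powR; rewrite ?lam0//; exact: ltW.
(* With [h <= e < lam / 4], every [i] with [L <= i.+1] has [i.+1 * h > lam - h > r + e], as the
   decay bound requires. *)
pose r := lam / 2.
have r0 : 0 < r by rewrite /r; lra.
pose C' := 6 * T * T `^ a * r `^ (a - 1) + 1.
have C'0 : 0 < C'.
  by rewrite /C' ltr_wpDl// !mulr_ge0 ?powR_ge0// ltW.
have [x1 x10 hx1] := @powR_small R (1 - a) (delta / 2 / C') ltac:(lra)
  (divr_gt0 (divr_gt0 d0 (ltr0n _ 2)) C'0).
exists (Num.min x1 (lam / 4)); first by rewrite lt_min x10/=; lra.
move=> e h m n e0; rewrite lt_min => /andP[ex1 el] m0 eE nT.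
have h0 : 0 < h.
  by move: e0; rewrite eE pmulr_rgt0// ltr0n.
have he : h <= e.
  by rewrite eE ler_peMl ?(ltW h0)// ler1n.
pose L := Num.truncn (lam / h).
have /andP[Ll Lg] : L%:R <= lam / h < L.+1%:R.
  by apply: truncn_itv; rewrite divr_ge0 ?ltW.
have {}Ll : L%:R * h <= lam by rewrite -ler_pdivlMr.
have {}Lg : lam < L.+1%:R * h by rewrite -ltr_pdivrMr.
have mL : (m <= L)%N.
  suff : m%:R * h < L.+1%:R * h by rewrite ltr_pM2r// ltr_nat.
  by rewrite -eE; lra.
pose K1 := m%:R * absp a (2 * e).
pose K2 := m%:R * (2 * e * r `^ (a - 1)).
have absp_e : absp a e <= absp a (2 * e).
  by apply: ler_absp => //; rewrite !ger0_norm; lra.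
have eK1 : m%:R * absp a (m%:R * h) <= K1 by rewrite -eE ler_wpM2l.
have VK1 i : halfsum a h m i <= K1 by rewrite /K1 eE halfsum_le.
have VK2 i : (L <= i.+1)%N -> halfsum a h m i <= K2.
  move=> Li; rewrite /K2 eE; apply: halfsum_le_decay => //.
  have : L%:R * h <= i.+1%:R * h by rewrite ler_wpM2r ?(ltW h0)// ler_nat.
  by move: Lg; rewrite -eE /r -natr1 mulrDl mul1r; lra.
have := grid_quadratic_form_le a0 a1 h0 m0 nT mL eK1 VK1 VK2.
rewrite -eE; set Q := \sum_(i < n) _ => HQ.
pose k1 := e * absp a (2 * e); pose k2 := e * (2 * e * r `^ (a - 1)).
have k10 : 0 <= k1 by rewrite mulr_ge0 ?absp_ge0// ltW.
have k20 : 0 <= k2 by rewrite !mulr_ge0 ?powR_ge0 ?(ltW e0).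
have n0 : 0 <= n%:R * h by rewrite mulr_ge0// ltW.
have HL : absp a (L%:R * h) <= lam `^ a.
  rewrite /absp ger0_norm ?mulr_ge0 ?(ltW h0)//.
  by apply: ge0_ler_powR; rewrite ?nnegrE ?mulr_ge0 ?(ltW h0) ?(ltW a0) ?(ltW lam0).
(* One factor [h] turns [m] into [e], the other turns [n] and [L] into lengths bounded by [T] and
   [lam]. *)
have HQ2 : h ^+ 2 * Q <= k1 * (2 * T `^ a * lam + 3 * T * lam `^ a) + k2 * (3 * T * T `^ a).
  apply: (le_trans (ler_wpM2l (sqr_ge0 h) HQ)).
  have -> : h ^+ 2 * (2 * (T `^ a * (L%:R * K1 + n%:R * K2)) +
    n%:R * (3 * (absp a (L%:R * h) * K1) + T `^ a * K2)) =
    2 * T `^ a * ((L%:R * h) * k1 + (n%:R * h) * k2) +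
    (n%:R * h) * (3 * (absp a (L%:R * h) * k1) + T `^ a * k2).
    have -> : k1 = h * K1 by rewrite /k1 /K1 {1}eE; ring.
    have -> : k2 = h * K2 by rewrite /k2 /K2 {1}eE; ring.
    by ring.
  have -> : k1 * (2 * T `^ a * lam + 3 * T * lam `^ a) + k2 * (3 * T * T `^ a) =
    2 * T `^ a * (lam * k1 + T * k2) + T * (3 * (lam `^ a * k1) + T `^ a * k2) by ring.
  apply: lerD.
    by rewrite ler_wpM2l ?mulr_ge0// lerD// ler_wpM2r.
  apply: ler_pM => //.
    apply: addr_ge0; first by apply: mulr_ge0 => //; apply: mulr_ge0 => //; exact: absp_ge0.
    exact: mulr_ge0.
  by rewrite lerD2r ler_wpM2l// ler_wpM2r.
have ee0 : 0 <= e `^ (1 - a) / e ^+ 2 by rewrite divr_ge0 ?powR_ge0 ?sqr_ge0.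
apply: (le_trans (ler_wpM2l ee0 HQ2)).
have en0 : e != 0 by rewrite gt_eqF.
have E1 : e `^ (1 - a) / e ^+ 2 * k1 = 2 `^ a.
  rewrite /k1 /absp ger0_norm; last by lra.
  rewrite powRM ?(ltW e0)//.
  have : e `^ (1 - a) * e `^ a = e.
    by rewrite -powRD ?en0 ?implybT// subrK powRr1// ltW.
  move=> H; rewrite -[RHS]mulr1.
  have -> : e `^ (1 - a) / e ^+ 2 * (e * (2 `^ a * e `^ a)) =
    2 `^ a * ((e `^ (1 - a) * e `^ a) / e) by field.
  by rewrite H divff.
have E2 : e `^ (1 - a) / e ^+ 2 * k2 = 2 * (r `^ (a - 1) * e `^ (1 - a)).
  by rewrite /k2; field.
rewrite mulrDr [X in X + _]mulrA E1 [X in _ + X]mulrA E2.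
have p2 : 2 `^ a <= 2 :> R.
  by apply: ler1_powR; [rewrite ler1n|exact: ltW].
have B1 : 2 `^ a * (2 * T `^ a * lam + 3 * T * lam `^ a) <= delta / 2.
  apply: (@le_trans _ _ (C * lam `^ a)); last by rewrite mulrC -ler_pdivlMr.
  have P1 : 2 * T `^ a * lam + 3 * T * lam `^ a <= (2 * T `^ a + 3 * T) * lam `^ a.
    by rewrite [leRHS]mulrDl lerD2r ler_wpM2l// mulr_ge0.
  have P0 : 0 <= 2 * T `^ a * lam + 3 * T * lam `^ a.
    by apply: addr_ge0; rewrite !mulr_ge0 ?powR_ge0// ltW.
  by rewrite /C -[leRHS]mulrA ler_pM// powR_ge0.
have B2 : 2 * (r `^ (a - 1) * e `^ (1 - a)) * (3 * T * T `^ a) <= delta / 2.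
  have he1 := hx1 e (ltW e0) (ltW ex1).
  apply: (@le_trans _ _ (C' * e `^ (1 - a))); last by rewrite mulrC -ler_pdivlMr.
  rewrite /C'; have := powR_ge0 e (1 - a).
  by rewrite mulrDl mul1r; lra.
by move: B1 B2; lra.
Qed.

(** * Riemann sums of continuous functions *)

Section riemann_sums.
Context {R : realType}.
Let mu := @lebesgue_measure R.
Implicit Types (f : R -> R) (a b c e h T : R).

Lemma continuous_normP f x : {for x, continuous f} ->
  forall e, 0 < e -> exists2 d, 0 < d & forall y, `|x - y| < d -> `|f x - f y| < e.
Proof.
move=> cf e e0.
have /cvgrPdist_lt /(_ e e0) /nbhs_ballP[d /= d0 hd] : f y @[y --> x] --> f x by [].
by exists d => // y xy; apply: hd.
Qed.

(** Compactness in near-covering form: half of a radius valid at one point serves all points close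
    to it. Only [x] is confined to the segment. *)
Lemma heine f a b e : continuous f -> 0 < e -> exists2 d, 0 < d &
  forall x y, a <= x <= b -> `|x - y| < d -> `|f x - f y| < e.
Proof.
move=> cf e0.
have /compact_near_coveringP cK := @segment_compact R a b.
have := cK R (0^'+) (fun d x => forall y, `|x - y| < d -> `|f x - f y| < e) _.
move=> /(_ _)[].
  move=> x _.
  have [d d0 hd] := continuous_normP (cf x) (divr_gt0 e0 (ltr0n _ 2)).
  exists (ball x (d / 2), [set r | 0 < r < d / 2]) => /=.
    split; first by apply: nbhsx_ballx; lra.
    near=> r; apply/andP; split; near: r; first exact: nbhs_right_gt.
    by apply: nbhs_right_lt; lra.
  move=> [x' r] /= [xx' /andP[r0 rd]] y x'y.
  have h1 : `|f x - f x'| < e / 2 by apply: hd; rewrite /ball/= in xx'; lra.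
  have h2 : `|f x - f y| < e / 2.
    apply: hd; rewrite (_ : x - y = (x - x') + (x' - y)); last by ring.
    by rewrite (le_lt_trans (ler_normD _ _))//; rewrite /ball/= in xx'; lra.
  rewrite (_ : f x' - f y = (f x - f y) - (f x - f x')); last by ring.
  by rewrite (le_lt_trans (ler_normB _ _))//; lra.
move=> d /= d0 hd.
exists (d / 2); first lra.
move=> x y xab xy; apply: (hd (d / 2)) => //=; rewrite ?in_itv//=; try lra.
by rewrite sub0r normrN gtr0_norm; lra.
Unshelve. all: by end_near. Qed.

Lemma continuous_itv_integrable f a b : continuous f ->
  mu.-integrable `[a, b] (EFin \o f).
Proof.
move=> cf; apply: continuous_compact_integrable; first exact: segment_compact.
exact: continuous_subspaceT.
Qed.

Lemma integrable_itv_oc f a b : continuous f ->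
  mu.-integrable `]a, b] (EFin \o f).
Proof.
move=> cf; apply: integrableS (continuous_itv_integrable a b cf) => //.
by apply: subset_itvr; rewrite bnd_simp.
Qed.

Lemma Rintegral_near_cst f a b c e : continuous f -> a <= b ->
  (forall x, a < x <= b -> `|f x - c| <= e) ->
  `|\int[mu]_(x in `]a, b]) f x - c * (b - a)| <= e * (b - a).
Proof.
move=> cf ab fc.
have mab : fine (mu `]a, b]) = b - a.
  rewrite /mu lebesgue_measure_itv/= lte_fin; case: ltP => //= ba.
  by apply/eqP; rewrite eq_sym subr_eq0 eq_le ab ba.
have ic k : mu.-integrable `]a, b] (EFin \o (fun=> k)).
  by apply: integrable_itv_oc => x; exact: cvg_cst.
rewrite -[in c * _]mab -(Rintegral_cst mu (measurable_itv `]a, b]) c).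
rewrite -RintegralB//; [|exact: integrable_itv_oc..].
apply: (le_trans (le_normr_Rintegral _ _)) => //.
  by apply: (@integrable_itv_oc (fun x => f x - c)) => x; apply: cvgB; [exact: cf|exact: cvg_cst].
rewrite -[in e * _]mab -(Rintegral_cst mu (measurable_itv `]a, b]) e).
apply: le_Rintegral => //.
  apply: (@integrable_itv_oc (fun x => `|f x - c|)) => x.
  by apply: cvg_norm; apply: cvgB; [exact: cf|exact: cvg_cst].
Qed.

Lemma Rintegral_split f a b c : continuous f -> a <= b -> b <= c ->
  \int[mu]_(x in `[a, c]) f x =
  \int[mu]_(x in `[a, b]) f x + \int[mu]_(x in `]b, c]) f x.
Proof.
move=> cf ab bc; rewrite -(@Rintegral_itvB _ f (BLeft a) (BRight c) b)//.
- by rewrite addrC subrK.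
- exact: continuous_itv_integrable.
Qed.

Lemma riemann_sum_error f h e n : continuous f -> 0 < h ->
  (forall x y, 0 <= x <= n%:R * h -> `|x - y| <= h -> `|f x - f y| <= e) ->
  `|\int[mu]_(x in `[0, n%:R * h]) f x - h * \sum_(i < n) f (i%:R * h)| <=
    e * (n%:R * h).
Proof.
move=> cf h0; elim: n => [|n IH] H.
  rewrite mul0r big_ord0 !mulr0 set_itv1 Rintegral_set1.
  by rewrite subrr normr0.
have nS : n.+1%:R * h = n%:R * h + h by rewrite -natr1 mulrDl mul1r.
have n0 : 0 <= n%:R * h by rewrite mulr_ge0// ltW.
rewrite nS (@Rintegral_split _ _ (n%:R * h))//; last by lra.
rewrite big_ord_recr/= !mulrDr opprD addrACA (le_trans (ler_normD _ _))// lerD//.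
  by apply: IH => x y xn xy; apply: H => //; rewrite nS; lra.
have := @Rintegral_near_cst f (n%:R * h) (n%:R * h + h) (f (n%:R * h)) e cf.
have -> : n%:R * h + h - n%:R * h = h by ring.
rewrite [f _ * h]mulrC; apply; first by lra.
by move=> x xn; apply: H; [rewrite nS; lra|rewrite ger0_norm; lra].
Qed.

(** The mesh [e / m.+1] divides [e], so a shift by [e] is a shift by [m.+1] grid points and
    telescoping applies. The grid may stop short of [T], but by less than one mesh. *)
Lemma riemann_sum_cvg f T e : continuous f -> 0 <= T -> 0 < e ->
  (fun m => e / m.+1%:R *
     \sum_(i < Num.truncn (T / (e / m.+1%:R))) f (i%:R * (e / m.+1%:R))) @ \oo -->
  \int[mu]_(x in `[0, T]) f x.
Proof.
move=> cf T0 e0.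
have [M M0 HM] : exists2 M, 0 < M & forall x, 0 <= x <= T -> `|f x| <= M.
  have /compact_bounded[M [_ mrt]] := continuous_compact
    (continuous_subspaceT cf) (@segment_compact R 0 T).
  exists (`|M| + 1); first by rewrite ltr_wpDl.
  move=> x xT; apply: (mrt (`|M| + 1)); first by rewrite (le_lt_trans (ler_norm _))// ltrDl.
  by exists x => //=; rewrite in_itv.
apply/cvgrPdist_le => eta eta0.
(* Half of [eta] pays for the grid and half for the leftover interval; [T + 1] also covers
   [T = 0]. *)
have [d d0 hd] := @heine f 0 T (eta / 2 / (T + 1)) cf ltac:(by rewrite !divr_gt0//; lra).
have hm : e / m.+1%:R @[m --> \oo] --> 0.
  rewrite -(mulr0 e); apply: cvgM; first exact: cvg_cst.
  exact: cvg_harmonic.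
have d1 : 0 < Num.min d (eta / 2 / M) by rewrite lt_min d0/= !divr_gt0.
move/cvgrPdist_lt: hm => /(_ _ d1) hm.
near=> m.
set h := e / m.+1%:R; set n := Num.truncn _.
have h0 : 0 < h by rewrite divr_gt0.
have hh : h < Num.min d (eta / 2 / M).
  suff : `|0 - e / m.+1%:R| < Num.min d (eta / 2 / M).
    by rewrite sub0r normrN ger0_norm// divr_ge0// ltW.
  by near: m.
move: hh; rewrite lt_min => /andP[hd' hM].
have /andP[nT Tn] : n%:R <= T / h < n.+1%:R by apply: truncn_itv; rewrite divr_ge0// ltW.
have {}nT : n%:R * h <= T by rewrite -ler_pdivlMr.
have {}Tn : T < n%:R * h + h by move: Tn; rewrite ltr_pdivrMr// -natr1 mulrDl mul1r.
have n0 : 0 <= n%:R * h by rewrite mulr_ge0// ltW.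
rewrite (@Rintegral_split _ _ (n%:R * h))// addrAC.
rewrite (le_trans (ler_normD _ _))//.
have E1 : `|\int[mu]_(x in `[0, n%:R * h]) f x - h * \sum_(i < n) f (i%:R * h)| <= eta / 2.
  apply: (@le_trans _ _ (eta / 2 / (T + 1) * (n%:R * h))).
    apply: riemann_sum_error => // x y xn xy; apply/ltW/hd; lra.
  rewrite mulrAC ler_pdivrMr; last lra.
  by rewrite ler_wpM2l; lra.
have E2 : `|\int[mu]_(x in `]n%:R * h, T]) f x| <= eta / 2.
  have := @Rintegral_near_cst f (n%:R * h) T 0 M cf nT.
  rewrite mul0r subr0 => /(_ _)/le_trans; apply.
    by move=> x xn; rewrite subr0 HM//; lra.
  by move: hM; rewrite ltr_pdivlMr// => hM; nra.
lra.
Unshelve. all: by end_near. Qed.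

End riemann_sums.

(** * The constant cH *)

Section second_difference_integral.
Context {R : realType} (a : R).
Hypotheses (a0 : 0 < a) (a1 : a < 1).
Let mu := @lebesgue_measure R.

(** Subadditivity gives the modulus of continuity: values at [u] and [v] differ by at most
    [|u - v|^a]. *)
Lemma continuous_absp : continuous (absp a).
Proof.
move=> x; apply/cvgrPdist_le => e e0.
have [d d0 hd] := powR_small a0 e0.
near=> y.
have xy : `|x - y| `^ a <= e.
  by apply: hd => //; apply/ltW; near: y; exists d.
have tri u v : absp a u - absp a v <= `|u - v| `^ a.
  rewrite lerBlDr /absp; apply: le_trans (powR_subadd a0 a1 _ _) => //.
  apply: ge0_ler_powR; rewrite ?nnegrE ?addr_ge0// ?(ltW a0)//.
  by rewrite -{1}(subrK v u) ler_normD.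
rewrite (le_trans _ xy)// ler_norml tri andbT.
by rewrite lerNl opprB distrC tri.
Unshelve. all: by end_near. Qed.

Lemma continuous_diff2 e : continuous (diff2 a e).
Proof.
have shift c : continuous (fun y => absp a (y + c)).
  move=> x; apply: (@cvg_comp _ _ _ (fun y => y + c) (absp a) _ _ _ _ (@continuous_absp (x + c))).
  by apply: cvgD; [exact: cvg_id|exact: cvg_cst].
move=> x; apply: cvgB; first by apply: cvgD; exact: shift.
by apply: cvgM; [exact: cvg_cst|exact: continuous_absp].
Qed.

(** The Riemann sums telescope to a [halfsum] plus [1], and the latter times the mesh vanishes. In
    [r + 2], one unit is the step of the difference and the other covers the rounding of the
    grid. *)
Lemma Rintegral_diff2_le r : 0 < r ->
  \int[mu]_(x in `[0, r + 2]) diff2 a 1 x <= 2 * r `^ (a - 1).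
Proof.
move=> r0.
have h1 := @riemann_sum_cvg R (diff2 a 1) (r + 2) 1 (continuous_diff2 (e := 1))
  ltac:(lra) ltr01.
have h2 : 2 * r `^ (a - 1) + 1 / m.+1%:R @[m --> \oo] --> 2 * r `^ (a - 1).
  rewrite -[X in _ --> X]addr0; apply: cvgD; first exact: cvg_cst.
  by under eq_fun do rewrite div1r; exact: cvg_harmonic.
apply: ler_cvg_to h1 h2 _; apply: nearW => m /=.
set h := 1 / m.+1%:R; set n := Num.truncn _.
have h0 : 0 < h by rewrite divr_gt0.
have mh : m.+1%:R * h = 1 by rewrite /h mul1r divff.
have hle1 : h <= 1 by rewrite -mh ler_peMl ?(ltW h0)// ler1n.
have /andP[_ Tn] : n%:R <= (r + 2) / h < n.+1%:R.
  by apply: truncn_itv; rewrite divr_ge0// ?(ltW h0)//; lra.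
have {}Tn : r + 2 < n%:R * h + h by move: Tn; rewrite ltr_pdivrMr// -[n.+1%:R]natr1 mulrDl mul1r.
have n0 : (0 < n)%N.
  by rewrite lt0n; apply/eqP => n0; move: Tn; rewrite n0 mul0r; lra.
have -> : \sum_(i < n) diff2 a 1 (i%:R * h) = halfsum a h m.+1 n.-1 + 1.
  have := @sum_diff2E R a a0 a1 h m.+1 h0 (ltn0Sn m) n.-1.
  by rewrite prednK// mh => ->; rewrite /absp normr1 powR1.
rewrite mulrDr mulr1 lerD2r.
have := @halfsum_le_decay R a a0 a1 h m.+1 h0 (ltn0Sn m) n.-1 r r0.
rewrite prednK// mh mulr1 => /(_ ltac:(lra)) H.
apply: (le_trans (ler_wpM2l (ltW h0) H)).
by rewrite mulrCA mulrA mh mul1r.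
Qed.

(** The integrand is nonpositive beyond [1], so truncation at [r + 2] can only increase the
    integral; then [r] is taken large. *)
Lemma Rintegral_diff2_le0 : \int[mu]_(x in `[0%R, +oo[) diff2 a 1 x <= 0.
Proof.
set c := \int[mu]_(x in _) _.
suff H r : 0 < r -> c <= 2 * r `^ (a - 1).
  rewrite leNgt; apply/negP => c0.
  have c4 : 0 < c / 4 by lra.
  (* This [r] makes the bound equal to [c / 2]. *)
  have := H ((c / 4) `^ (a - 1)^-1) (powR_gt0 _ c4).
  by rewrite -powRrM mulVf ?powRr1 ?(ltW c4)//; [lra|rewrite subr_eq0 lt_eqF].
move=> r0; have hr := Rintegral_diff2_le r0.
pose f x := (diff2 a 1 x)%:E.
have mf : measurable_fun setT f.
  apply/measurable_EFinP; apply: continuous_measurable_fun.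
  exact: continuous_diff2.
have mfD D : measurable_fun D f by exact: measurable_funS mf.
have sub : [set` `[0%R, r + 2]] `<=` [set` `[0%R, +oo[].
  by move=> x /=; rewrite !in_itv/= => /andP[->].
have le1 : (\int[mu]_(x in `[0%R, +oo[) f x <= \int[mu]_(x in `[0%R, (r + 2)%R]) f x)%E.
  rewrite integralE [leRHS]integralE; apply: leeB; last first.
    apply: ge0_subset_integral => //; apply: measurable_funeneg; exact: mfD.
  have -> : [set` `[0%R, +oo[] = `[0%R, r + 2]%classic `|` `]r + 2, +oo[%classic.
    by apply: itv_bndbnd_setU; rewrite bnd_simp//; lra.
  rewrite ge0_integral_setU//=; last 2 first.
  - by apply: measurable_funepos; exact: mfD.
  - by apply: lt_disjoint => x y; rewrite !in_itv/= andbT => /andP[_ xr] /(le_lt_trans xr).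
  rewrite [X in (_ + X)%E]integral0_eq ?adde0// => x; rewrite /= in_itv/= andbT => rx.
  rewrite funeposE /f; apply/max_idPr; rewrite lee_fin diff2_le0//; lra.
have fin : (\int[mu]_(x in `[0%R, (r + 2)%R]) f x)%E =
    (\int[mu]_(x in `[0%R, (r + 2)%R]) diff2 a 1 x)%:E.
  rewrite /Rintegral fineK//; apply: integrable_fin_num => //.
  by apply: continuous_itv_integrable; exact: continuous_diff2.
have r2 : 0 <= 2 * r `^ (a - 1) by rewrite mulr_ge0 ?powR_ge0.
rewrite /c /Rintegral; move: le1; rewrite fin.
(* An infinite integral would have [fine] value [0], which the nonnegative bound also dominates. *)
case: (\int[mu]_(x in `[0%R, +oo[) f x)%E => [v||]//=.
by rewrite lee_fin => /le_trans; apply.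
Qed.

End second_difference_integral.

Lemma cH_le0 (R : realType) (H : R) : 0 < H -> H < 1 / 2 -> cH H <= 0.
Proof. by move=> H0 H1; apply: Rintegral_diff2_le0; lra. Qed.

(** * Second moments *)

Section normal_second_moment.
Context {R : realType}.
Let mu := @lebesgue_measure R.
Let nu : probability _ R := normal_prob (0 : R) 1.

(** The Radon-Nikodym derivative and the Gaussian density have the same integral over every
    measurable set, so they agree almost everywhere. *)
Lemma ge0_integral_normal_prob (f : R -> R) : measurable_fun setT f ->
  (forall x, 0 <= f x) ->
  (\int[nu]_x (f x)%:E = \int[mu]_x ((f x)%:E * (normal_pdf 0 1 x)%:E))%E.
Proof.
move=> mf f0.
have dom : nu `<< mu by exact: normal_prob_dominates.
rewrite -(Radon_Nikodym_SigmaFinite.change_of_variables dom)//; last first.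
  exact/measurable_EFinP.
have fi := Radon_Nikodym_SigmaFinite.f_integrable dom.
have mp : measurable_fun setT (fun x : R => (normal_pdf 0 1 x)%:E).
  by apply/measurable_EFinP; exact: measurable_normal_pdf.
apply: ae_eq_integral => //.
- apply: emeasurable_funM; first exact/measurable_EFinP.
  exact: measurable_int fi.
- by apply: emeasurable_funM => //; exact/measurable_EFinP.
- apply: ae_eqe_mul2l; apply: integral_ae_eq => //.
  by move=> E _ mE; rewrite -Radon_Nikodym_SigmaFinite.f_integral.
Qed.

(** Comparison with the normal density of variance [2]: with [y = x^2 / 4], the inequality
    [y * exp (- y) <= 1] gives [x^2 exp (- x^2 / 2) <= 4 exp (- x^2 / 4)]. *)
Lemma normal_second_moment_lty : (\int[nu]_x (x ^+ 2)%:E < +oo)%E.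
Proof.
rewrite ge0_integral_normal_prob//; last by move=> x; exact: sqr_ge0.
pose s : R := Num.sqrt 2.
have s0 : s != 0 by rewrite gt_eqF// sqrtr_gt0.
pose C := 4 * normal_peak 1 / normal_peak s.
have C0 : 0 <= C by rewrite divr_ge0 ?normal_peak_ge0// mulr_ge0 ?normal_peak_ge0.
have le x : (x ^+ 2) * normal_pdf 0 1 x <= C * normal_pdf 0 s x.
  rewrite !normal_pdfE ?oner_eq0// /normal_fun /C.
  rewrite [leRHS](_ : _ = normal_peak 1 * (4 * expR (- (x - 0) ^+ 2 / (s ^+ 2 *+ 2)))); last first.
    by field; rewrite gt_eqF// normal_peak_gt0.
  rewrite mulrCA ler_wpM2l ?normal_peak_ge0//.
  rewrite sqr_sqrtr// subr0 expr1n.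
  set y := x ^+ 2 / 4.
  have -> : - x ^+ 2 / (1 *+ 2) = - y + - y by rewrite /y; field.
  have -> : - x ^+ 2 / (2 *+ 2) = - y by rewrite /y; field.
  have -> : x ^+ 2 = 4 * y by rewrite /y; field.
  rewrite expRD mulrA -[leRHS]mul1r mulrA ler_wpM2r ?expR_ge0//.
  have : 1 + y <= expR y := expR_ge1Dx y.
  have := expR_gt0 (- y); have := expRxMexpNx_1 y; have := expR_gt0 y.
  nra.
apply: (@le_lt_trans _ _ (\int[mu]_x (C%:E * (normal_pdf 0 s x)%:E))%E).
  apply: ge0_le_integral => //.
  - by move=> x _; rewrite -EFinM lee_fin mulr_ge0 ?sqr_ge0 ?normal_pdf_ge0.
  - apply: emeasurable_funM; apply/measurable_EFinP; first exact: measurable_funX.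
    exact: measurable_normal_pdf.
  - apply: emeasurable_funM => //; apply/measurable_EFinP.
    exact: measurable_normal_pdf.
  - by move=> x _; rewrite -!EFinM lee_fin.
rewrite ge0_integralZl//; first by rewrite integral_normal_pdf mule1 ltry.
- by apply/measurable_EFinP; exact: measurable_normal_pdf.
- by move=> x _; rewrite lee_fin normal_pdf_ge0.
Qed.

End normal_second_moment.

(** * Linear calculus of expectations *)

Section mean.
Context {R : realType} {d : measure_display} {Omega : measurableType d}.
Variable P : probability Omega R.
Implicit Types X Y : Omega -> R.

(** Integrability travels with the value, so that linear combinations need no separate side
    conditions. *)
Definition has_mean X (x : R) : Prop :=
  P.-integrable setT (EFin \o X) /\ (\int[P]_w (X w)%:E = x%:E)%E.

Lemma has_mean_ge0 X x : measurable_fun setT X -> (forall w, 0 <= X w) ->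
  (\int[P]_w (X w)%:E = x%:E)%E -> has_mean X x.
Proof.
move=> mX X0 EX; split=> //; apply/integrableP; split; first exact/measurable_EFinP.
under eq_integral do rewrite gee0_abs ?lee_fin//.
by rewrite EX ltry.
Qed.

Lemma has_mean_lin X Y x y a : has_mean X x -> has_mean Y y ->
  has_mean (fun w => a * X w + Y w) (a * x + y).
Proof.
move=> [iX EX] [iY EY].
have iaX : P.-integrable setT (fun w => (a%:E * (X w)%:E)%E) by exact: integrableZl.
split; first exact: (integrableD _ iaX iY).
under eq_integral do rewrite EFinD EFinM.
rewrite (integralD _ iaX iY)//.
by rewrite (integralZl _ iX)// EX EY.
Qed.

Lemma has_mean0 : has_mean (fun=> 0) 0.
Proof. by split; [exact: integrable0|rewrite integral0]. Qed.

Lemma has_meanZ X x a : has_mean X x -> has_mean (fun w => a * X w) (a * x).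
Proof.
move=> hX; have := has_mean_lin a hX has_mean0.
by rewrite addr0; congr has_mean; apply/funext => w; rewrite addr0.
Qed.

Lemma has_meanD X Y x y : has_mean X x -> has_mean Y y ->
  has_mean (fun w => X w + Y w) (x + y).
Proof.
move=> hX hY; have := has_mean_lin 1 hX hY.
by rewrite mul1r; congr has_mean; apply/funext => w; rewrite mul1r.
Qed.

Lemma has_mean_sum n (X : 'I_n -> Omega -> R) (x : 'I_n -> R) :
  (forall i, has_mean (X i) (x i)) ->
  has_mean (fun w => \sum_(i < n) X i w) (\sum_(i < n) x i).
Proof.
elim: n X x => [|n IH] X x hX.
  rewrite big_ord0 (_ : (fun w => _) = fun=> 0); first exact: has_mean0.
  by apply/funext => w; rewrite big_ord0.
rewrite big_ord_recr (_ : (fun w => _) =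
  fun w => \sum_(i < n) X (widen_ord (leqnSn n) i) w + X ord_max w).
  by apply: has_meanD => //; apply: IH.
by apply/funext => w; rewrite big_ord_recr.
Qed.

Lemma second_moment_law (X : Omega -> R)
    (m : {measure set (measurableTypeR R) -> \bar R}) :
  measurable_fun setT X -> (forall A, measurable A -> P (X @^-1` A) = m A) ->
  (\int[P]_w (X w ^+ 2)%:E = \int[m]_x (x ^+ 2)%:E)%E.
Proof.
move=> mX Xm; pose Xf : Omega -> measurableTypeR R := X.
have mXf : measurable_fun setT Xf by exact: mX.
pose X' : {RV P >-> measurableTypeR R} :=
  HB.pack Xf (isMeasurableFun.Build _ _ _ _ Xf mXf).
transitivity (\int[distribution P X']_x (x ^+ 2)%:E)%E; last first.
  by apply: eq_measure_integral => A mA _; exact: Xm.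
rewrite (ge0_integral_distribution X' (f := fun x : R => (x ^+ 2)%:E))//.
- by apply/measurable_EFinP; exact: measurable_funX.
- by move=> x; rewrite lee_fin sqr_ge0.
Qed.

End mean.

(** * Second moments of fractional Brownian motion *)

Section fbm_moments.
Context {R : realType} {d : measure_display} {Omega : measurableType d}.
Variable P : probability Omega R.

Definition normal2 : R := fine (\int[normal_prob (0 : R) 1]_x (x ^+ 2)%:E)%E.

Lemma normal2E : (\int[normal_prob (0 : R) 1]_x (x ^+ 2)%:E = normal2%:E)%E.
Proof.
rewrite /normal2 fineK// ge0_fin_numE; first exact: normal_second_moment_lty.
by apply: integral_ge0 => x _; rewrite lee_fin sqr_ge0.
Qed.

(* The second moment of the standard normal law need not be computed: a
   combination with variance [v > 0], divided by [sqrt v], is standard normal. *)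
Lemma fbm_second_moment (H : R) (B : R -> Omega -> R) n (ts a : 'I_n -> R) :
  is_fBm P H B -> (forall i, 0 <= ts i) ->
  let v := \sum_(i < n) \sum_(j < n) a i * a j * fbm_cov H (ts i) (ts j) in
  0 <= v ->
  has_mean P (fun w => (\sum_(i < n) a i * B (ts i) w) ^+ 2) (normal2 * v).
Proof.
move=> [mB _ gB] ts0 v v0.
have mL (c : 'I_n -> R) : measurable_fun setT (fun w => \sum_(i < n) c i * B (ts i) w).
  by apply: measurable_sum => i; apply: measurable_funM => //; exact: mB.
apply: has_mean_ge0; first exact: measurable_funX.
  by move=> w; exact: sqr_ge0.
have [v0'|vn0] := eqVneq v 0.
  rewrite (@second_moment_law _ _ _ P _ (\d_(0 : measurableTypeR R))) //; last first.
    move=> A mA; have := gB n ts a ts0 A mA.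
    by rewrite -/v v0' eqxx.
  rewrite integral_dirac//=; last by apply/measurable_EFinP; exact: measurable_funX.
  by rewrite diracT mul1e expr0n v0' mulr0.
have vp : 0 < v by rewrite lt_neqAle eq_sym vn0.
have sp : 0 < Num.sqrt v by rewrite sqrtr_gt0.
pose c i := a i / Num.sqrt v.
have vc : \sum_(i < n) \sum_(j < n) c i * c j * fbm_cov H (ts i) (ts j) = 1.
  transitivity (v / v); last by rewrite divff.
  rewrite {1}/v mulr_suml; apply: eq_bigr => i _; rewrite mulr_suml; apply: eq_bigr => j _.
  rewrite -[in RHS](sqr_sqrtr v0) /c; field; lra.
have Ec : (\int[P]_w ((\sum_(i < n) c i * B (ts i) w) ^+ 2)%:E = normal2%:E)%E.
  rewrite -normal2E.
  apply: second_moment_law => // A mA.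
  have := gB n ts c ts0 A mA.
  by rewrite vc oner_eq0 sqrtr1.
have [_ ] := has_meanZ v (has_mean_ge0 (measurable_funX 2 (mL c)) (fun w => sqr_ge0 _) Ec).
rewrite [v * _]mulrC => <-; apply: eq_integral => w _; congr EFin.
rewrite -[in RHS](sqr_sqrtr v0) -exprMn mulr_sumr; congr (_ ^+ 2).
by apply: eq_bigr => i _; rewrite /c; field; rewrite gt_eqF.
Qed.

Definition is_pm1 (c : R) := c = 1 \/ c = -1.

Lemma fbm_pair_second_moment (H : R) (B : R -> Omega -> R) (s t c : R) :
  0 < H -> H < 1 / 2 -> is_fBm P H B -> 0 <= s -> 0 <= t -> is_pm1 c ->
  has_mean P (fun w => (B s w + c * B t w) ^+ 2)
    (normal2 * (fbm_cov H s s + 2 * c * fbm_cov H s t + fbm_cov H t t)).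
Proof.
move=> H0 H1 fB s0 t0 hc.
pose ts := fun i : 'I_2 => if i == ord0 then s else t.
pose a := fun i : 'I_2 => if i == ord0 then 1 else c.
have ts0 i : 0 <= ts i by rewrite /ts; case: ifP.
have := fbm_second_moment (ts := ts) (a := a) fB ts0.
rewrite !big_ord_recl !big_ord0 /ts /a /=.
have cc : c * c = 1 by case: hc => ->; ring.
have csym : fbm_cov H t s = fbm_cov H s t.
  by rewrite /fbm_cov distrC [t `^ _ + _]addrC.
have -> : 1 * 1 * fbm_cov H s s + (1 * c * fbm_cov H s t + 0) +
   (c * 1 * fbm_cov H t s + (c * c * fbm_cov H t t + 0) + 0) =
   fbm_cov H s s + 2 * c * fbm_cov H s t + fbm_cov H t t.
  by rewrite csym cc; ring.
have -> : (fun w => (\sum_(i < 2) (if i == ord0 then 1 else c) *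
    B (if i == ord0 then s else t) w) ^+ 2) = (fun w => (B s w + c * B t w) ^+ 2).
  by apply/funext => w; rewrite !big_ord_recl big_ord0 /= mul1r addr0.
apply; rewrite /fbm_cov !subrr normr0 powR0; last by rewrite gt_eqF//; lra.
(* Nonnegativity of the variance: subadditivity is what the sign [c = 1] uses. *)
have sub : `|t - s| `^ (2 * H) <= s `^ (2 * H) + t `^ (2 * H).
  apply: le_trans (powR_subadd (a := 2 * H) _ _ s0 t0); [|lra|lra].
  apply: ge0_ler_powR; rewrite ?nnegrE ?addr_ge0//; first lra.
  by rewrite ler_norml; lra.
have := powR_ge0 s (2 * H); have := powR_ge0 t (2 * H).
have := powR_ge0 (`|t - s|) (2 * H).
by case: hc => ->; lra.
Qed.

End fbm_moments.

(** * Independence *)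

Section independence.
Context {R : realType} {d : measure_display} {Omega : measurableType d}.
Variable P : probability Omega R.
Local Open Scope ereal_scope.

(** Dynkin's argument: the events independent of [C] form a lambda-system containing the pi-system
    [G]. *)
Lemma indep_g_sigma_algebra_l (G : set (set Omega)) (C : set Omega) :
  setI_closed G -> G `<=` measurable -> measurable C ->
  (forall A, G A -> P (A `&` C) = P A * P C) ->
  forall A, <<s G >> A -> P (A `&` C) = P A * P C.
Proof.
move=> GI mG mC GC A sA.
suff : <<s G >> `<=` [set A | measurable A /\ P (A `&` C) = P A * P C].
  by move=> /(_ _ sA)[].
apply: lambda_system_subset => //; last by move=> B GB; split; [exact: mG|exact: GC].
apply/dynkin_lambda_system; split => /=.
- by split; [exact: measurableT|rewrite setTI probability_setT mul1e].
- move=> B [mB PB]; split; first exact: measurableC.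
  have -> : ~` B `&` C = C `\` B by rewrite setDE setIC.
  rewrite measureD//; last by rewrite -ge0_fin_numE// fin_num_measure.
  rewrite [X in _ - X](_ : _ = P B * P C); last by rewrite setIC.
  rewrite probability_setC// muleBl ?mul1e ?fin_num_measure//.
- move=> F tF HF; split; first by apply: bigcup_measurable => k _; exact: (HF k).1.
  rewrite setI_bigcupl measure_bigcup//=; last 2 first.
  - by move=> k _; apply: measurableI => //; exact: (HF k).1.
  - exact: trivIset_setIr.
  rewrite measure_bigcup//=; last by move=> k _; exact: (HF k).1.
  have PC : P C = (fine (P C))%:E by rewrite fineK// fin_num_measure.
  rewrite muleC PC -nneseriesZl//.
  by apply: eq_eseriesr => k _; rewrite (HF k).2 muleC -PC.
Qed.

Lemma indep_g_sigma_algebra (G K : set (set Omega)) :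
  setI_closed G -> G `<=` measurable -> setI_closed K -> K `<=` measurable ->
  (forall A C, G A -> K C -> P (A `&` C) = P A * P C) ->
  forall A C, <<s G >> A -> <<s K >> C -> P (A `&` C) = P A * P C.
Proof.
move=> GI mG KI mK GK A C sA sC.
have sm : <<s G >> `<=` measurable.
  by apply: smallest_sub => //; exact: sigma_algebra_measurable.
rewrite setIC muleC; apply: indep_g_sigma_algebra_l sC => //; first exact: sm.
move=> {}C KC; rewrite setIC muleC; apply: indep_g_sigma_algebra_l sA => //.
- exact: mK.
- by move=> {}A GA; exact: GK.
Qed.

(** A pi-system generating the sigma-algebra of the pair [(X, Y)]; cylinder independence speaks
    directly about such events. *)
Definition pair_rectangles (X Y : Omega -> R) : set (set Omega) :=
  [set E | exists A B, [/\ measurable A, measurable B & E = X @^-1` A `&` Y @^-1` B]].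

Lemma setI_closed_pair_rectangles X Y : setI_closed (pair_rectangles X Y).
Proof.
move=> _ _ [A [B [mA mB ->]]] [A' [B' [mA' mB' ->]]].
exists (A `&` A'), (B `&` B'); split; try exact: measurableI.
by rewrite !preimage_setI setIACA.
Qed.

Lemma pair_rectangles_measurable X Y : measurable_fun setT X -> measurable_fun setT Y ->
  pair_rectangles X Y `<=` measurable.
Proof.
move=> mX mY _ [A [B [mA mB ->]]].
by apply: measurableI; rewrite -[X in measurable X]setTI; [exact: mX|exact: mY].
Qed.

Lemma g_sigma_pair_rectangles X Y c A : measurable A ->
  <<s pair_rectangles X Y >> ((fun w => (X w + c * Y w)%R) @^-1` A).
Proof.
move=> mA; pose T' := g_sigma_algebraType (pair_rectangles X Y).
have mX : measurable_fun [set: T'] (X : T' -> R).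
  move=> _ B mB; rewrite setTI; apply: sub_sigma_algebra.
  by exists B, setT; rewrite preimage_setT setIT.
have mY : measurable_fun [set: T'] (Y : T' -> R).
  move=> _ B mB; rewrite setTI; apply: sub_sigma_algebra.
  by exists setT, B; rewrite preimage_setT setTI.
have mU : measurable_fun [set: T'] (fun w : T' => (X w + c * Y w)%R).
  by apply: measurable_funD => //; apply: measurable_funM.
by have := mU measurableT A mA; rewrite setTI.
Qed.

(** The joint law agrees with the product law on rectangles, hence everywhere; Tonelli then factors
    the integral, whose integrand is nonnegative. *)
Lemma indep_sqr_mean (U V : Omega -> R) :
  measurable_fun setT U -> measurable_fun setT V ->
  (forall A B, measurable A -> measurable B ->
    P (U @^-1` A `&` V @^-1` B) = P (U @^-1` A) * P (V @^-1` B)) ->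
  \int[P]_w ((U w ^+ 2 * V w ^+ 2)%R)%:E =
  \int[P]_w (U w ^+ 2)%:E * \int[P]_w (V w ^+ 2)%:E.
Proof.
move=> mU mV UV.
pose U' : {RV P >-> R} := HB.pack U (isMeasurableFun.Build _ _ _ _ U mU).
pose V' : {RV P >-> R} := HB.pack V (isMeasurableFun.Build _ _ _ _ V mV).
have mUV : measurable_fun setT (fun w => (U w, V w)) by exact: measurable_fun_pair.
pose W' : {RV P >-> (R * R)%type} :=
  HB.pack (fun w => (U w, V w)) (isMeasurableFun.Build _ _ _ _ _ mUV).
have mX2 : measurable_fun setT (fun x : R => (x ^+ 2)%:E).
  by apply/measurable_EFinP; exact: measurable_funX.
have msq : measurable_fun setT (fun z : R * R => ((z.1 ^+ 2 * z.2 ^+ 2)%R)%:E).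
  apply/measurable_EFinP; apply: measurable_funM; apply: measurable_funX.
    exact: measurable_fst.
  exact: measurable_snd.
transitivity (\int[distribution P W']_z ((z.1 ^+ 2 * z.2 ^+ 2)%R)%:E).
  rewrite ge0_integral_distribution//.
  by move=> z; rewrite lee_fin mulr_ge0 ?sqr_ge0.
transitivity (\int[distribution P U' \x distribution P V']_z ((z.1 ^+ 2 * z.2 ^+ 2)%R)%:E).
  apply: eq_measure_integral => A mA _.
  by apply/esym/product_measure_unique.
rewrite fubini_tonelli1//; last by move=> z; rewrite lee_fin mulr_ge0 ?sqr_ge0.
rewrite /fubini_F/=.
have -> : \int[P]_w (V w ^+ 2)%:E = \int[distribution P V']_y (y ^+ 2)%:E.
  by rewrite ge0_integral_distribution// => y; rewrite lee_fin sqr_ge0.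
have -> : \int[P]_w (U w ^+ 2)%:E = \int[distribution P U']_y (y ^+ 2)%:E.
  by rewrite ge0_integral_distribution// => y; rewrite lee_fin sqr_ge0.
rewrite -ge0_integralZr//; last 2 first.
- by move=> x _; rewrite lee_fin sqr_ge0.
- by apply: integral_ge0 => x _; rewrite lee_fin sqr_ge0.
apply: eq_integral => x _.
rewrite -ge0_integralZl//; last by rewrite lee_fin sqr_ge0.
by move=> y _; rewrite lee_fin sqr_ge0.
Qed.

End independence.

(** * The second moment of the forward integral *)

Section fbm_products.
Context {R : realType} {d : measure_display} {Omega : measurableType d}.
Variables (P : probability Omega R) (H : R) (B1 B2 : R -> Omega -> R).
Hypotheses (H0 : 0 < H) (H1 : H < 1 / 2).
Hypotheses (fB1 : is_fBm P H B1) (fB2 : is_fBm P H B2).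
Hypothesis B12 : indep_processes P B1 B2.

Let mB1 s : 0 <= s -> measurable_fun setT (B1 s). Proof. by case: fB1 => + _ _; apply. Qed.
Let mB2 s : 0 <= s -> measurable_fun setT (B2 s). Proof. by case: fB2 => + _ _; apply. Qed.

Let cyl2 (B : R -> Omega -> R) s t (A : 'I_2 -> set R) :
  cyl B (fun i : 'I_2 => if i == ord0 then s else t) A =
  B s @^-1` A ord0 `&` B t @^-1` A ord_max.
Proof.
apply/seteqP; split => w /=; first by move=> h; split; [exact: (h ord0)|exact: (h ord_max)].
move=> [h1 h2] i; case: eqP => [->//|/eqP i0].
suff -> : i = ord_max by [].
by apply/val_inj; case: i i0 => -[|[|]].
Qed.

Lemma indep_fbm_pairs s t p q A A' C C' :
  0 <= s -> 0 <= t -> 0 <= p -> 0 <= q ->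
  measurable A -> measurable A' -> measurable C -> measurable C' ->
  P ((B1 s @^-1` A `&` B1 t @^-1` A') `&` (B2 p @^-1` C `&` B2 q @^-1` C')) =
  (P (B1 s @^-1` A `&` B1 t @^-1` A') * P (B2 p @^-1` C `&` B2 q @^-1` C'))%E.
Proof.
move=> s0 t0 p0 q0 mA mA' mC mC'.
have := B12 (n := 2) (m := 2) (s := fun i => if i == ord0 then s else t)
  (A := fun i => if i == ord0 then A else A')
  (t := fun i => if i == ord0 then p else q)
  (C := fun i => if i == ord0 then C else C').
rewrite !cyl2 /=; apply => i; by case: ifP.
Qed.

(** Squares come first because Tonelli needs only nonnegativity. Independence passes from cylinders
    to linear combinations through the generated sigma-algebras. *)
Lemma mean_sqr_products s t p q c c' :
  0 <= s -> 0 <= t -> 0 <= p -> 0 <= q -> is_pm1 c -> is_pm1 c' ->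
  has_mean P (fun w => (B1 s w + c * B1 t w) ^+ 2 * (B2 p w + c' * B2 q w) ^+ 2)
   (normal2 ^+ 2 * ((fbm_cov H s s + 2 * c * fbm_cov H s t + fbm_cov H t t) *
     (fbm_cov H p p + 2 * c' * fbm_cov H p q + fbm_cov H q q))).
Proof.
move=> s0 t0 p0 q0 hc hc'.
have mU : measurable_fun setT (fun w => B1 s w + c * B1 t w).
  by apply: measurable_funD; [exact: mB1|apply: measurable_funM => //; exact: mB1].
have mV : measurable_fun setT (fun w => B2 p w + c' * B2 q w).
  by apply: measurable_funD; [exact: mB2|apply: measurable_funM => //; exact: mB2].
apply: has_mean_ge0.
- by apply: measurable_funM; exact: measurable_funX.
- by move=> w; rewrite mulr_ge0 ?sqr_ge0.
rewrite (indep_sqr_mean mU mV).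
  have [_ ->] := fbm_pair_second_moment H0 H1 fB1 s0 t0 hc.
  have [_ ->] := fbm_pair_second_moment H0 H1 fB2 p0 q0 hc'.
  by rewrite -EFinM; congr EFin; ring.
move=> A C mA mC.
apply: (@indep_g_sigma_algebra _ _ _ P (pair_rectangles (B1 s) (B1 t))
  (pair_rectangles (B2 p) (B2 q))).
- exact: setI_closed_pair_rectangles.
- by apply: pair_rectangles_measurable; exact: mB1.
- exact: setI_closed_pair_rectangles.
- by apply: pair_rectangles_measurable; exact: mB2.
- move=> _ _ [A1 [A2 [mA1 mA2 ->]]] [C1 [C2 [mC1 mC2 ->]]].
  exact: indep_fbm_pairs.
- exact: g_sigma_pair_rectangles.
- exact: g_sigma_pair_rectangles.
Qed.

Lemma mean_products s t p q : 0 <= s -> 0 <= t -> 0 <= p -> 0 <= q ->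
  has_mean P (fun w => B1 s w * B1 t w * (B2 p w * B2 q w))
    (normal2 ^+ 2 * (fbm_cov H s t * fbm_cov H p q)).
Proof.
move=> s0 t0 p0 q0.
have hp : is_pm1 (1 : R) by left.
have hm : is_pm1 (-1 : R) by right.
have h c c' := mean_sqr_products (c := c) (c' := c') s0 t0 p0 q0.
(* Polarization in each factor. *)
have := has_meanD
  (has_meanD (has_meanZ (16^-1) (h 1 1 hp hp)) (has_meanZ (- 16^-1) (h 1 (-1) hp hm)))
  (has_meanD (has_meanZ (- 16^-1) (h (-1) 1 hm hp)) (has_meanZ (16^-1) (h (-1) (-1) hm hm))).
congr has_mean; last by field.
by apply/funext => w; field.
Qed.

(** In the four covariances of the expanded increments all one-time powers cancel, which leaves half
    of a second difference. *)
Lemma mean_increment_products s t e : 0 <= s -> 0 <= t -> 0 <= e ->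
  has_mean P (fun w => B1 s w * B1 t w *
      ((B2 (s + e) w - B2 s w) * (B2 (t + e) w - B2 t w)))
    (normal2 ^+ 2 * (fbm_cov H s t * (diff2 (2 * H) e (s - t) / 2))).
Proof.
move=> s0 t0 e0.
have se0 : 0 <= s + e by rewrite addr_ge0.
have te0 : 0 <= t + e by rewrite addr_ge0.
have h p q p0 q0 := mean_products (p := p) (q := q) s0 t0 p0 q0.
have := has_meanD (has_meanD (h (s + e) (t + e) se0 te0) (has_meanZ (- 1) (h (s + e) t se0 t0)))
  (has_meanD (has_meanZ (- 1) (h s (t + e) s0 te0)) (h s t s0 t0)).
congr has_mean; first by apply/funext => w; ring.
rewrite /fbm_cov /diff2 /absp.
have -> : t + e - (s + e) = - (s - t) by ring.
have -> : t - (s + e) = - (s - t + e) by ring.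
have -> : t + e - s = - (s - t - e) by ring.
have -> : t - s = - (s - t) by ring.
by rewrite !normrN; field.
Qed.

Lemma mean_riemann_sum_sqr (e h : R) n : 0 < e -> 0 <= h ->
  has_mean P (fun w => (h * \sum_(i < n)
      B1 (i%:R * h) w * ((B2 (i%:R * h + e) w - B2 (i%:R * h) w) / e)) ^+ 2)
    (normal2 ^+ 2 / 2 / e ^+ 2 * (h ^+ 2 * \sum_(i < n) \sum_(j < n)
      (absp (2 * H) (i%:R * h) + absp (2 * H) (j%:R * h)
       - absp (2 * H) ((i%:R - j%:R) * h)) / 2
      * diff2 (2 * H) e ((i%:R - j%:R) * h))).
Proof.
move=> e0 h0.
have ih0 (i : nat) : 0 <= i%:R * h by rewrite mulr_ge0.
have := has_meanZ (h ^+ 2 / e ^+ 2) (has_mean_sum (fun i : 'I_n => has_mean_sum (fun j : 'I_n =>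
  mean_increment_products (ih0 i) (ih0 j) (ltW e0)))).
congr has_mean.
  apply/funext => w; rewrite [RHS]exprMn [X in _ = _ * X]expr2 big_distrlr/=.
  rewrite [LHS]mulr_sumr [RHS]mulr_sumr; apply: eq_bigr => i _.
  rewrite [LHS]mulr_sumr [RHS]mulr_sumr; apply: eq_bigr => j _.
  by field; rewrite gt_eqF.
rewrite !mulr_sumr; apply: eq_bigr => i _; rewrite !mulr_sumr; apply: eq_bigr => j _.
rewrite -mulrBl /fbm_cov /absp [`|j%:R * h - _|]distrC -mulrBl.
rewrite [`|i%:R * h|]ger0_norm// [`|j%:R * h|]ger0_norm//.
by field; rewrite gt_eqF.
Qed.

End fbm_products.

(** Freezing a path before time [0] extends it to the whole line, since [t |-> max t 0] is
    1-Lipschitz. *)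
Lemma continuous_max0 (R : realType) (f : R -> R) :
  {within `[0, +oo[, continuous f} -> continuous (fun t : R => f (Num.max t 0)).
Proof.
move=> /subspace_continuousP cf x.
have x0 : [set` `[0, +oo[] (Num.max x 0) by rewrite /= in_itv/= andbT le_max lexx orbT.
apply/cvgrPdist_lt => e e0.
have /cvgrPdist_lt /(_ e e0) := cf _ x0.
rewrite near_withinE => /nbhs_ballP[d /= d0 hd].
near=> y; apply: hd => /=; last by rewrite in_itv/= andbT le_max lexx orbT.
rewrite /ball/=.
have xy : `|x - y| < d by near: y; exists d.
apply: le_lt_trans xy.
by rewrite /Num.max; case: ltP => ?; case: ltP => ?; rewrite ler_norml;
  have := ler_norm (x - y); have := ler_norm (- (x - y)); rewrite normrN; lra.
Unshelve. all: by end_near. Qed.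

(** * The forward integral as a limit of Riemann sums *)

Section forward_integral.
Context {R : realType} {d : measure_display} {Omega : measurableType d}.
Variables (P : probability Omega R) (H T : R) (B1 B2 : R -> Omega -> R).
Hypotheses (H0 : 0 < H) (H1 : H < 1 / 2) (T0 : 0 < T).
Hypotheses (fB1 : is_fBm P H B1) (fB2 : is_fBm P H B2).
Hypothesis B12 : indep_processes P B1 B2.

Let grid e m : R := e / m.+1%:R.
Let npts e m := Num.truncn (T / grid e m).

Let RS e m w := grid e m * \sum_(i < npts e m)
  B1 (i%:R * grid e m) w * ((B2 (i%:R * grid e m + e) w - B2 (i%:R * grid e m) w) / e).

Let cvg_RS e w : 0 < e -> RS e m w @[m --> \oo] --> Gtilde T B1 B2 e w.
Proof.
move=> e0.
have c1 : continuous (fun t : R => B1 (Num.max t 0) w).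
  by apply: (@continuous_max0 _ (fun t => B1 t w)); case: fB1 => _ + _; apply.
have c2 : continuous (fun t : R => B2 (Num.max t 0) w).
  by apply: (@continuous_max0 _ (fun t => B2 t w)); case: fB2 => _ + _; apply.
pose f (u : R) := B1 (Num.max u 0) w * ((B2 (Num.max (u + e) 0) w - B2 (Num.max u 0) w) / e).
have cf : continuous f.
  move=> x; apply: cvgM; first exact: c1.
  apply: cvgM; last exact: cvg_cst.
  apply: cvgB; last exact: c2.
  apply: (@cvg_comp _ _ _ (fun y => y + e) (fun t : R => B2 (Num.max t 0) w) _ _ _ _ (c2 (x + e))).
  by apply: cvgD; [exact: cvg_id|exact: cvg_cst].
have fE u : 0 <= u -> f u = B1 u w * ((B2 (u + e) w - B2 u w) / e).
  by move=> u0; rewrite /f !max_l//; lra.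
have := riemann_sum_cvg cf (ltW T0) e0.
have -> : \int[lebesgue_measure]_(x in `[0, T]) f x = Gtilde T B1 B2 e w.
  by apply: eq_Rintegral => u; rewrite inE/= in_itv/= => /andP[u0 _]; exact: fE.
suff -> : (fun m => RS e m w) = (fun m => e / m.+1%:R *
   \sum_(i < Num.truncn (T / (e / m.+1%:R))) f (i%:R * (e / m.+1%:R))) by [].
apply/funext => m; rewrite /RS; congr (_ * _).
by apply: eq_bigr => i _; rewrite fE// mulr_ge0// divr_ge0// ltW.
Qed.

Let measurable_RS e m : 0 < e -> measurable_fun setT (RS e m).
Proof.
move=> e0; have h0 : 0 <= grid e m by rewrite divr_ge0// ltW.
have mB1 s : 0 <= s -> measurable_fun setT (B1 s) by case: fB1 => + _ _; apply.
have mB2 s : 0 <= s -> measurable_fun setT (B2 s) by case: fB2 => + _ _; apply.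
apply: measurable_funM => //; apply: measurable_sum => i.
have ih0 : 0 <= i%:R * grid e m by rewrite mulr_ge0.
apply: measurable_funM; first exact: mB1.
apply: measurable_funM => //; apply: measurable_funB; apply: mB2 => //.
by rewrite addr_ge0// ltW.
Qed.

Lemma measurable_Gtilde e : 0 < e -> measurable_fun setT (Gtilde T B1 B2 e).
Proof.
move=> e0; apply: (measurable_fun_cvg (fun m => measurable_RS m e0)) => w _.
exact: cvg_RS.
Qed.

Lemma Gtilde_second_moment_small (delta : R) : 0 < delta ->
  exists2 e0 : R, 0 < e0 & forall e, 0 < e -> e < e0 ->
    (\int[P]_w ((e `^ (1 / 2 - H) * Gtilde T B1 B2 e w) ^+ 2)%:E <= delta%:E)%E.
Proof.
move=> delta0.
have a0 : 0 < 2 * H by rewrite mulr_gt0.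
have a1 : 2 * H < 1 by rewrite mulrC -ltr_pdivlMr.
(* The added [1] keeps [K] positive. *)
pose K : R := normal2 ^+ 2 + 1.
have K0 : 0 < K by rewrite ltr_wpDl ?sqr_ge0.
have [e0 e00 he0] := @grid_quadratic_form_small R (2 * H) T (delta / K)
  a0 a1 T0 (divr_gt0 delta0 K0).
exists e0 => // e ep elt.
have eh : (e `^ (1 / 2 - H)) ^+ 2 = e `^ (1 - 2 * H).
  rewrite -powR_mulrn ?powR_ge0// -powRrM; by congr (_ `^ _); field.
pose X m w := (e `^ (1 / 2 - H) * RS e m w) ^+ 2.
have EX m : (\int[P]_w (X m w)%:E <= delta%:E)%E.
  have h0 : 0 <= grid e m by rewrite divr_ge0// ltW.
  have [_] := has_meanZ (e `^ (1 - 2 * H))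
    (mean_riemann_sum_sqr H0 H1 fB1 fB2 B12 (npts e m) ep h0).
  rewrite (_ : (\int[P]_w (X m w)%:E)%E =
    (\int[P]_w (e `^ (1 - 2 * H) * RS e m w ^+ 2)%:E)%E); last first.
    by apply: eq_integral => w _; rewrite /X exprMn eh.
  move=> ->; rewrite lee_fin.
  have := he0 e (grid e m) m.+1 (npts e m) ep elt (ltn0Sn m).
  rewrite /grid mulrC divfK// -/(grid e m) => /(_ erefl).
  set Q := grid e m ^+ 2 * _; move=> hQ.
  have nT : (npts e m)%:R * grid e m <= T.
    rewrite -ler_pdivlMr ?divr_gt0//.
    by rewrite truncn_le divr_ge0// ltW.
  have {}hQ := hQ nT.
  have -> : e `^ (1 - 2 * H) * (normal2 ^+ 2 / 2 / e ^+ 2 * Q) =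
    (normal2 ^+ 2 / 2) * (e `^ (1 - 2 * H) / e ^+ 2 * Q).
    by field; rewrite gt_eqF.
  have n20 : 0 <= (normal2 : R) ^+ 2 by exact: sqr_ge0.
  apply: (@le_trans _ _ ((normal2 ^+ 2 / 2) * (delta / K))).
    by rewrite ler_wpM2l// divr_ge0.
  rewrite mulrCA -[leRHS]mulr1 ler_wpM2l ?(ltW delta0)//.
  by rewrite ler_pdivrMr// mul1r /K; lra.
have mX m : measurable_fun setT (fun w => (X m w)%:E).
  apply/measurable_EFinP; apply: measurable_funX; apply: measurable_funM => //.
  exact: measurable_RS.
have X0 m w : setT w -> (0 <= (X m w)%:E)%E by rewrite lee_fin sqr_ge0.
(* The bound on Riemann sums is uniform in the mesh, so it survives the pathwise limit. *)
have := fatou P measurableT mX X0.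
rewrite (_ : (\int[P]_w limn_einf (fun m => (X m w)%:E))%E =
  (\int[P]_w ((e `^ (1 / 2 - H) * Gtilde T B1 B2 e w) ^+ 2)%:E)%E); last first.
  apply: eq_integral => w _.
  apply: (cvg_limn_einf_sup _).1.
  apply: cvg_EFin; first exact: nearW.
  apply: (@cvg_comp _ _ _ (fun m => e `^ (1 / 2 - H) * RS e m w) (fun x => x ^+ 2)).
    by apply: cvgM; [exact: cvg_cst|exact: cvg_RS].
  exact: exprn_continuous.
move/le_trans; apply.
rewrite limn_einf_lim; apply: lime_le.
  by apply: is_cvg_einfs.
apply: nearW => m; apply: le_trans (EX m).
by apply: ereal_inf_lbound; exists m => /=.
Qed.

End forward_integral.

(** * Measurability of continuous functionals of the paths *)

Section countable_valued.
Context {R : realType} {d : measure_display} {Omega : measurableType d}.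

(** Every preimage is a countable union of fibres, so [f] may be arbitrary. *)
Lemma measurable_fun_countable (C : countType) (V : Omega -> C) (f : C -> R) :
  (forall c, measurable (V @^-1` [set c])) -> measurable_fun setT (f \o V).
Proof.
move=> mV _ A _; rewrite setTI.
have -> : (f \o V) @^-1` A = \bigcup_c (V @^-1` [set c] `&` [set w | A (f c)]).
  apply/seteqP; split => w /=; first by move=> Aw; exists (V w).
  by move=> [c _ [/= ->]].
apply: countable_bigcupT_measurable => // c.
have [Ac|nAc] := pselect (A (f c)).
  by rewrite (_ : [set _ | _] = setT) ?setIT//; apply/seteqP; split.
by rewrite (_ : [set _ | _] = set0) ?setI0//; apply/seteqP; split.
Qed.

End countable_valued.

Lemma continuous_sum_ord {R : realType} (n : nat) (f : nat -> R -> R) :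
  (forall i, continuous (f i)) -> continuous (fun t => \sum_(i < n) f i t).
Proof.
move=> cf; elim: n => [|n IH].
  by under eq_fun do rewrite big_ord0; move=> t; exact: cvg_cst.
under eq_fun do rewrite big_ord_recr/=.
by move=> t; apply: cvgD; [exact: IH|exact: cf].
Qed.

(** * Continuous interpolation of grid values *)

Section interpolation.
Context {R : realType} (T : R) (T0 : 0 < T).

(* Continuous bumps centred at the points [i T / n], normalised into a
   partition of unity. *)
Definition bump (n i : nat) (t : R) : R := Num.max 0 (T / n.+1%:R - `|t - i%:R * (T / n.+1%:R)|).

Definition interp (n : nat) (c : nat -> R) (t : R) : R :=
  (\sum_(i < n.+2) bump n i t * c i) / (\sum_(i < n.+2) bump n i t).

Lemma bump_ge0 n i t : 0 <= bump n i t.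
Proof. by rewrite le_max lexx. Qed.

Lemma continuous_bump n i : continuous (bump n i).
Proof.
move=> t; apply: (@continuous_max R R (fun=> 0)
  (fun t => T / n.+1%:R - `|t - i%:R * (T / n.+1%:R)|)); first exact: cvg_cst.
apply: cvgB; first exact: cvg_cst.
by apply: cvg_norm; apply: cvgB; [exact: cvg_id|exact: cvg_cst].
Qed.

(** The bump centred at the grid point just below [t] is positive at [t]. The endpoint [t = T] gives
    index [n.+1], hence [n.+2] bumps. *)
Lemma sum_bump_gt0 n t : 0 <= t <= T -> 0 < \sum_(i < n.+2) bump n i t.
Proof.
move=> /andP[t0 tT]; pose h := T / n.+1%:R.
have h0 : 0 < h by rewrite divr_gt0.
pose k := Num.truncn (t / h).
have /andP[k1 k2] : k%:R <= t / h < k.+1%:R by apply: truncn_itv; rewrite divr_ge0// ltW.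
have kn : (k < n.+2)%N.
  suff : k%:R <= n.+1%:R :> R by rewrite ler_nat.
  apply: (le_trans k1); rewrite ler_pdivrMr// /h mulrCA divff ?mulr1//.
rewrite (bigD1 (Ordinal kn))//= ltr_wpDr//.
  by apply: sumr_ge0 => i _; exact: bump_ge0.
rewrite /bump lt_max ltxx/= subr_gt0 -/h.
move: k1 k2; rewrite ler_pdivlMr// ltr_pdivrMr// -natr1 mulrDl mul1r => k1 k2.
by rewrite ger0_norm; lra.
Qed.

(** An interpolated value is a weighted average in which only nodes within one mesh of [t] have
    nonzero weight. *)
Lemma interp_near n c t y e : 0 <= t <= T ->
  (forall i, (i < n.+2)%N ->
    `|t - i%:R * (T / n.+1%:R)| < T / n.+1%:R -> `|c i - y| <= e) ->
  `|interp n c t - y| <= e.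
Proof.
move=> tT H; have S0 := sum_bump_gt0 n tT.
set S := \sum_(i < n.+2) _ in S0.
have -> : interp n c t - y = (\sum_(i < n.+2) bump n i t * (c i - y)) / S.
  rewrite /interp -/S -[y in LHS](mulfK (lt0r_neq0 S0)) -mulrBl; congr (_ / _).
  by rewrite mulrC /S mulr_suml -sumrB; apply: eq_bigr => i _; ring.
rewrite normrM normfV (gtr0_norm S0) ler_pdivrMr//.
apply: (le_trans (ler_norm_sum _ _ _)); rewrite mulrC /S mulr_suml.
apply: ler_sum => i _; rewrite normrM (ger0_norm (bump_ge0 _ _ _)).
have [b0|] := leP (T / n.+1%:R) `|t - i%:R * (T / n.+1%:R)|.
  rewrite (_ : bump n i t = 0) ?mul0r//.
  by apply/max_idPl; rewrite subr_le0.
by move=> b0; rewrite ler_wpM2l ?bump_ge0//; apply: H.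
Qed.

Lemma continuous_interp n c : {within `[0, T], continuous (interp n c)}.
Proof.
have csum (g : nat -> R) : continuous (fun t => \sum_(i < n.+2) bump n i t * g i).
  apply: (@continuous_sum_ord _ _ (fun i t => bump n i t * g i)) => i t.
  by apply: cvgM; [exact: continuous_bump|exact: cvg_cst].
have cS : continuous (fun t => \sum_(i < n.+2) bump n i t).
  by apply: continuous_sum_ord => i; exact: continuous_bump.
apply/subspace_continuousP => t; rewrite /= in_itv/= => tT.
apply: cvg_within_filter; apply: cvgM; first exact: csum.
by apply: cvgV; [rewrite gt_eqF// sum_bump_gt0|exact: cS].
Qed.

End interpolation.

Lemma within_continuous_pair {R : realType} (A : set R) (f g : R -> R) :
  {within A, continuous f} -> {within A, continuous g} ->
  {within A, continuous (fun t => (f t, g t))}.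
Proof. by move=> cf cg x; exact: (cvg_pair (cf x) (cg x)). Qed.

Section path_functional.
Context {R : realType} {d : measure_display} {Omega : measurableType d}.

Definition quant (n : nat) (x : R) : R := (Num.floor (n.+1%:R * x))%:~R / n.+1%:R.

Lemma quant_near n x : `|quant n x - x| <= n.+1%:R^-1.
Proof.
have n0 : (0 : R) < n.+1%:R by [].
have /andP[h1 h2] := floor_itv (n.+1%:R * x).
rewrite -(ler_pM2l n0) mulfV ?gt_eqF// -[X in X * `|_|](gtr0_norm n0) -normrM.
rewrite mulrBr /quant mulrCA divff ?mulr1 ?gt_eqF//.
by move: h2; rewrite intrD ler_norml; lra.
Qed.

Lemma measurable_floor_fiber n (Y : Omega -> R) (z : int) : measurable_fun setT Y ->
  measurable [set w | Num.floor (n.+1%:R * Y w) = z].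
Proof.
move=> mY.
have mN : measurable_fun setT (fun w => n.+1%:R * Y w) by exact: measurable_funM.
rewrite (_ : [set _ | _] = (fun w => n.+1%:R * Y w) @^-1` `[z%:~R, (z + 1)%:~R[).
  by rewrite -[X in measurable X]setTI; exact: mN.
apply/seteqP; split => w /=; rewrite in_itv/=; first by move=> <-; exact: floor_itv.
by move=> h; apply: floor_def.
Qed.

Variables (T : R) (T0 : 0 < T) (b1 b2 : R -> Omega -> R) (X : Omega -> R).
Hypotheses (mb1 : forall t, 0 <= t -> measurable_fun setT (b1 t))
           (mb2 : forall t, 0 <= t -> measurable_fun setT (b2 t))
           (mX : measurable_fun setT X).
Hypotheses (cb1 : forall w, {within `[0, +oo[, continuous (b1^~ w)})
           (cb2 : forall w, {within `[0, +oo[, continuous (b2^~ w)}).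
Variable F : (R -> R * R) -> R -> R.
Hypothesis bcF : bounded_continuous_functional T F.

Lemma continuous_path w : {within `[0, T], continuous (fun t => (b1 t w, b2 t w))}.
Proof.
have sub : [set` `[0, T]] `<=` [set` `[0, +oo[].
  by move=> x /=; rewrite !in_itv/= => /andP[->].
by apply: within_continuous_pair; apply: (continuous_subspaceW sub); [exact: cb1|exact: cb2].
Qed.

Let pt (n : nat) (i : nat) : R := i%:R * (T / n.+1%:R).

(* A path rounded to finitely many integers takes countably many values, so
   any function of the rounded path is measurable; [F] is the pointwise limit
   of such functions because it is continuous for uniform convergence. *)
Let code (n : nat) : countType := ({ffun 'I_n.+2 -> int * int} * int)%type.

Let encode (n : nat) (w : Omega) : code n :=
  ([ffun i : 'I_n.+2 => (Num.floor (n.+1%:R * b1 (pt n i) w),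
                        Num.floor (n.+1%:R * b2 (pt n i) w))],
   Num.floor (n.+1%:R * X w)).

Let decode (n : nat) (v : code n) : R :=
  F (fun t => (interp T n (fun i => (v.1 (inord i)).1%:~R / n.+1%:R) t,
               interp T n (fun i => (v.1 (inord i)).2%:~R / n.+1%:R) t))
    (v.2%:~R / n.+1%:R).

Let pt_ge0 n i : 0 <= pt n i.
Proof. by rewrite /pt mulr_ge0// divr_ge0// ltW. Qed.

Let measurable_decode_encode n : measurable_fun setT (@decode n \o encode n).
Proof.
apply: measurable_fun_countable => -[v z].
rewrite (_ : _ @^-1` _ = (\bigcap_(i : 'I_n.+2)
   ([set w | Num.floor (n.+1%:R * b1 (pt n i) w) = (v i).1] `&`
    [set w | Num.floor (n.+1%:R * b2 (pt n i) w) = (v i).2])) `&`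
   [set w | Num.floor (n.+1%:R * X w) = z]).
  apply: measurableI; last exact: measurable_floor_fiber.
  apply: fin_bigcap_measurable => // i _.
  by apply: measurableI; apply: measurable_floor_fiber; [exact: mb1|exact: mb2].
apply/seteqP; split => w /=.
  by move=> [<- <-]; split => // i _; rewrite ffunE.
move=> [h <-]; congr pair; apply/ffunP => i; rewrite ffunE.
by have [/= -> ->] := h i I; rewrite -surjective_pairing.
Qed.

(** Half of the error is the oscillation of the path over one mesh, the other half the rounding of
    its values. *)
Let interp_path_near (b : R -> Omega -> R) w (e : R) : 0 < e ->
  {within `[0, +oo[, continuous (b^~ w)} ->
  \forall n \near \oo, forall c t, 0 <= t <= T ->
    (forall i : 'I_n.+2, c i = quant n (b (pt n i) w)) ->
    `|interp T n (fun i => c (inord i)) t - b t w| <= e.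
Proof.
move=> e0 cb; have e20 : 0 < e / 2 by rewrite divr_gt0.
have [dl dl0 hd] := @heine _ _ 0 T _ (continuous_max0 cb) e20.
have h1 : T / n.+1%:R @[n --> \oo] --> 0.
  rewrite -(mulr0 T); apply: cvgM; first exact: cvg_cst.
  exact: cvg_harmonic.
have h2 : n.+1%:R^-1 @[n --> \oo] --> (0 : R) by exact: cvg_harmonic.
move/cvgrPdist_lt : h1 => /(_ _ dl0) h1; move/cvgrPdist_lt : h2 => /(_ _ e20) h2.
near=> n.
have hn1 : T / n.+1%:R < dl.
  suff : `|0 - T / n.+1%:R| < dl.
    by rewrite sub0r normrN ger0_norm// divr_ge0// ltW.
  by near: n.
have hn2 : n.+1%:R^-1 < e / 2.
  suff : `|0 - n.+1%:R^-1| < e / 2.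
    by rewrite sub0r normrN ger0_norm// invr_ge0.
  by near: n.
move=> c t tT cE; apply: interp_near => // i iltn ti.
have -> : c (inord i) = quant n (b (pt n i) w).
  by rewrite (cE (inord i)) inordK.
rewrite -(subrK (b (pt n i) w) (quant _ _)) -addrA (le_trans (ler_normD _ _))//.
have q := quant_near n (b (pt n i) w).
have {}ti := hd t (pt n i) tT (lt_trans ti hn1).
move: ti; rewrite !max_l//; last by case/andP: tT.
move=> ti; rewrite [leRHS]splitr; apply: lerD; first exact: le_trans q (ltW hn2).
by rewrite distrC; exact: ltW.
Unshelve. all: by end_near. Qed.

Lemma measurable_path_functional :
  measurable_fun setT (fun w => F (fun t => (b1 t w, b2 t w)) (X w)).
Proof.
apply: (measurable_fun_cvg measurable_decode_encode) => w _.
apply/cvgrPdist_lt => e e0.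
have [del del0 hdel] := bcF.2 _ (X w) (@continuous_path w) e e0.
have del20 : 0 < del / 2 by rewrite divr_gt0.
have dd : del / 2 < del by rewrite ltr_pdivrMr// ltr_pMr// ltr1n.
have n1 := interp_path_near del20 (@cb1 w).
have n2 := interp_path_near del20 (@cb2 w).
have h2 : n.+1%:R^-1 @[n --> \oo] --> (0 : R) by exact: cvg_harmonic.
move/cvgrPdist_lt : h2 => /(_ _ del20) h2.
near=> n.
have hn1 : forall c t, 0 <= t <= T -> (forall i : 'I_n.+2, c i = quant n (b1 (pt n i) w)) ->
    `|interp T n (fun i => c (inord i)) t - b1 t w| <= del / 2 by near: n.
have hn2 : forall c t, 0 <= t <= T -> (forall i : 'I_n.+2, c i = quant n (b2 (pt n i) w)) ->
    `|interp T n (fun i => c (inord i)) t - b2 t w| <= del / 2 by near: n.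
have hn3 : n.+1%:R^-1 < del / 2.
  suff : `|0 - n.+1%:R^-1| < del / 2.
    by rewrite sub0r normrN ger0_norm// invr_ge0.
  by near: n.
apply: hdel.
- by apply: within_continuous_pair; exact: continuous_interp.
- move=> t tT /=; split.
    rewrite distrC; apply: (@le_lt_trans _ _ (del / 2)) => //.
    apply: (hn1 (fun i => ((encode n w).1 i).1%:~R / n.+1%:R)) => // i.
    by rewrite ffunE.
  rewrite distrC; apply: (@le_lt_trans _ _ (del / 2)) => //.
  apply: (hn2 (fun i => ((encode n w).1 i).2%:~R / n.+1%:R)) => // i.
  by rewrite ffunE.
- by rewrite distrC; exact: le_lt_trans (quant_near n (X w)) (lt_trans hn3 dd).
Unshelve. all: by end_near. Qed.

End path_functional.

(** * Convergence *)

Section ae_convergence.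
Context {R : realType} {d : measure_display} {Omega : measurableType d}.
Variable mu : {measure set Omega -> \bar R}.

Lemma nneseries_sqr_cvg0 (x : nat -> R) :
  ((\sum_(n <oo) (x n ^+ 2)%:E)%E < +oo)%E -> x n @[n --> \oo] --> 0.
Proof.
move=> fin.
have fn : ((\sum_(n <oo) (x n ^+ 2)%:E)%E \is a fin_num)%E.
  by rewrite ge0_fin_numE// nneseries_ge0// => n _ _; rewrite lee_fin sqr_ge0.
have cs : cvgn (series (fun n => x n ^+ 2)).
  apply: nondecreasing_is_cvgn.
    by apply: nondecreasing_series => n _ _; exact: sqr_ge0.
  exists (fine (\sum_(n <oo) (x n ^+ 2)%:E)%E) => _ [k _ <-].
  rewrite -lee_fin fineK// /series/= -sumEFin.
  by apply: nneseries_lim_ge => n _ _; rewrite lee_fin sqr_ge0.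
have := cvg_series_cvg_0 cs; move=> /cvgrPdist_lt c0.
apply/cvgrPdist_lt => e e0; have e20 : 0 < e ^+ 2 by rewrite exprn_gt0.
have := c0 _ e20; apply: filterS => n /=.
rewrite !sub0r !normrN normrX => h.
by rewrite -(ltr_pXn2r (n := 2))// nnegrE// ltW.
Qed.

(** Exchanging sum and integral, the series of squares is integrable, hence almost everywhere
    finite, so its terms tend to [0]. *)
Lemma ae_cvg0_of_sum_sqr (X : nat -> Omega -> R) :
  (forall n, measurable_fun setT (X n)) ->
  (\sum_(n <oo) \int[mu]_w (X n w ^+ 2)%:E < +oo)%E ->
  {ae mu, forall w, X n w @[n --> \oo] --> 0}.
Proof.
move=> mX fin.
have mX2 n : measurable_fun setT (fun w => (X n w ^+ 2)%:E).
  by apply/measurable_EFinP; exact: measurable_funX.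
have X20 n w : setT w -> (0 <= (X n w ^+ 2)%:E)%E by rewrite lee_fin sqr_ge0.
have : mu.-integrable setT (fun w => (\sum_(n <oo) (X n w ^+ 2)%:E)%E).
  apply/integrableP; split.
    by apply: ge0_emeasurable_sum => // n w _ _; exact: X20.
  rewrite (eq_integral (fun w => (\sum_(n <oo) (X n w ^+ 2)%:E)%E)).
    by rewrite integral_nneseries.
  by move=> w _; rewrite gee0_abs// nneseries_ge0// => n _ _; exact: X20.
move=> /(integrable_ae measurableT); apply: filterS => w /(_ I) h.
apply: nneseries_sqr_cvg0; rewrite -ge0_fin_numE//.
by apply: nneseries_ge0 => n _ _; exact: X20.
Qed.

End ae_convergence.

Lemma Slim_eq0 (R : realType) (d : measure_display) (Omega : measurableType d)
  (H T : R) (B : R -> Omega -> R) w : 0 < H -> H < 1 / 2 -> Slim H T B w = 0.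
Proof.
move=> H0 H1; apply: ler0_sqrtr; apply: mulr_le0_ge0; first exact: cH_le0.
by apply: Rintegral_ge0 => u _; exact: sqr_ge0.
Qed.

Theorem theorem6p1 (R : realType) (d : measure_display) (Omega : measurableType d)
  (P : probability Omega R) (H T : R) (B1 B2 : R -> Omega -> R) (N : Omega -> R) :
  0 < H -> H < 1 / 2 -> 0 < T ->
  is_fBm P H B1 -> is_fBm P H B2 -> indep_processes P B1 B2 ->
  measurable_fun setT N -> centered_gaussian P N 1 ->
  indep_rv_processes P N B1 B2 ->
  forall F : (R -> R * R) -> R -> R,
    bounded_continuous_functional T F ->
    (fun eps : R => 'E_P[fun w => F (fun t => (B1 t w, B2 t w))
                     (eps `^ (1 / 2 - H) * Gtilde T B1 B2 eps w)%R])%E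
      @ (0:R)^'+ -->
    ('E_P[fun w => F (fun t => (B1 t w, B2 t w)) (N w * Slim H T B1 w)%R])%E.
Proof.
move=> H0 H1 T0 fB1 fB2 B12 _ _ _ F bcF.
pose X eps w := eps `^ (1 / 2 - H) * Gtilde T B1 B2 eps w.
pose path w := (fun t => (B1 t w, B2 t w)) : R -> R * R.
have mB1 t : 0 <= t -> measurable_fun setT (B1 t) by case: fB1 => + _ _; apply.
have mB2 t : 0 <= t -> measurable_fun setT (B2 t) by case: fB2 => + _ _; apply.
have cB1 w : {within `[0, +oo[, continuous (B1^~ w)} by case: fB1.
have cB2 w : {within `[0, +oo[, continuous (B2^~ w)} by case: fB2.
have mX eps : 0 < eps -> measurable_fun setT (X eps).
  by move=> e0; apply: measurable_funM => //; exact: (measurable_Gtilde T0 fB1 fB2).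
have mF Y : measurable_fun setT Y -> measurable_fun setT (fun w => F (path w) (Y w)).
  by move=> mY; exact: (measurable_path_functional T0 mB1 mB2 mY cB1 cB2 bcF).
(* The limit functional is evaluated at [0], as [Slim] vanishes. *)
have -> : (fun w => F (fun t => (B1 t w, B2 t w)) (N w * Slim H T B1 w)) =
    (fun w => F (path w) 0).
  by apply/funext => w; rewrite Slim_eq0// mulr0.
rewrite unlock => U nU; apply: contrapT => nH.
(* Failure at a neighbourhood [U] yields, for each [n], a parameter outside [U] with second moment
   at most [2^-(n + 1)]; these bounds sum to at most [1]. *)
have sel n : exists eps : R, [/\ 0 < eps,
    (\int[P]_w (X eps w ^+ 2)%:E <= (1 / (2 ^ n.+1)%:R)%:E)%E &
    ~ U (\int[P]_w (F (path w) (X eps w))%:E)%E].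
  have d0 : 0 < 1 / (2 ^ n.+1)%:R :> R by rewrite divr_gt0// ltr0n expn_gt0.
  have [e0 e00 he0] := Gtilde_second_moment_small H0 H1 T0 fB1 fB2 B12 d0.
  apply: contrapT => nex; apply: nH.
  suff : \forall eps \near (0 : R)^'+, U (\int[P]_w (F (path w) (X eps w))%:E)%E by [].
  near=> eps; apply: contrapT => nUe; apply: nex; exists eps; split=> //.
  by apply: he0.
have [u hu] := choice sel.
have u0 n : 0 < u n by have [] := hu n.
have Xcvg : {ae P, forall w, X (u n) w @[n --> \oo] --> 0}.
  apply: ae_cvg0_of_sum_sqr => [n|]; first exact: mX.
  apply: (@le_lt_trans _ _ 1%E); last exact: ltry.
  apply: le_trans (epsilon_trick0 xpredT ler01).
  apply: lee_nneseries => [n _ _|n _]; last by have [] := hu n.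
  by apply: integral_ge0 => w _; rewrite lee_fin sqr_ge0.
have [[M hM] cF] := bcF.
have mF0 : measurable_fun setT (fun w => (F (path w) 0)%:E).
  by apply/measurable_EFinP; exact: (mF (fun=> 0)).
have mFn n : measurable_fun setT (fun w => (F (path w) (X (u n) w))%:E).
  by apply/measurable_EFinP; apply: mF; exact: mX.
(* The constant [M] dominates. Convergence of the integrals puts them eventually in [U], against the
   choice of [u]. *)
have [||_ _ /(_ U nU)[n _ /(_ n (leqnn n))]] := dominated_convergence measurableT
  mFn mF0 _ (finite_measure_integrable_cst P M measurableT) _.
- apply: filterS Xcvg => w Xw _; apply: cvg_EFin; first exact: nearW.
  apply/cvgrPdist_lt => e e0.
  have [del del0 hdel] := cF (path w) 0 (continuous_path cB1 cB2 (w := w)) e e0.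
  move/cvgrPdist_lt: Xw => /(_ _ del0); apply: filterS => n Xn.
  apply: hdel => //; first exact: continuous_path.
  by move=> t _; rewrite !subrr normr0.
- by apply: nearW => w n _; rewrite lee_fin hM.
by have [_ _ nUn] := hu n; exact: nUn.
Unshelve. all: by end_near. Qed.
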